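(* For all $a,b\in\mathbb N_0$, the set $S_{a,b}=\{d_c\mid c\in\mathrm{Conn}(a,b)\}$ is a basis of $\mathrm{Hom}_{\mathrm{sBr}}(a,b)$. In particular $\mathrm{Hom}_{\mathrm{sBr}}(a,b)$ has dimension $(a+b-1)!!$ if $a+b$ is even and is $0$ otherwise.
   Context: Work over $\mathbb C$; in a monoidal supercategory the super interchange law $(f\otimes g)\circ(h\otimes k)=(-1)^{\bar g\bar h}(f\circ h)\otimes(g\circ k)$ holds. The Brauer supercategory $\mathrm{sBr}$ is the $\mathbb C$-linear strict monoidal supercategory generated by one object $\star$ and morphisms $s:\star\otimes\star\to\star\otimes\star$ (even), $b:\star\otimes\star\to\mathbb 1$ (odd), $b^*:\mathbb 1\to\star\otimes\star$ (odd), subject to: (R1) $s\circ s=1$, $(s\otimes 1)(1\otimes s)(s\otimes 1)=(1\otimes s)(s\otimes1)(1\otimes s)$; (R2) $(b\otimes 1_\star)\circ(1_\star\otimes b^* )=-1_\star$, $(1_\star\otimes b)\circ(b^*\otimes 1_\star)=1_\star$; (R3) $(1_\star\otimes s)\circ(b^*\otimes 1_\star)=(s\otimes 1_\star)\circ(1_\star\otimes b^* )$, $s\circ b^*=-b^*$. Objects are identified with $a\in\mathbb N_0$. A diagram is a morphism obtained as a finite composite of tensor products of generators and identities; it is drawn (read bottom to top) by depicting $s$ as a crossing, $b$ as a cap (arc joining two bottom points), $b^*$ as a cup (arc joining two top points), identities as vertical strands. The resulting curves are strings: a string with both ends on top is a cup, with both ends on the bottom a cap, with one end on each a through string, with no ends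 a loop. For $d:a\to b$ without loops, the connector $P(d)$ is the partition of the $a+b$ endpoints into pairs joined by strings; $\mathrm{Conn}(a,b)$ is the set of all perfect matchings of these $a+b$ points. A diagram is normal if: any two strings intersect at most once; no string intersects itself; no two cups or caps are at the same height; all cups are above all caps; the heights of caps decrease when caps are ordered left to right by their left ends; the heights of cups increase when cups are ordered left to right by their left ends. For each $c\in\mathrm{Conn}(a,b)$ a normal diagram $d_c$ with $P(d_c)=c$ is fixed. *)

(* Defs.v *)
From HB Require Import structures.
From mathcomp Require Import all_boot all_order all_algebra.
From Stdlib Require Import Relations.
Set Implicit Arguments. Unset Strict Implicit. Unset Printing Implicit Defensive.
Import GRing.Theory.

Inductive gen := GS | GCap | GCup.

Definition gen_to_nat g := match g with GS => 0 | GCap => 1 | GCup => 2 end.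
Definition nat_to_gen n :=
  match n with 0 => Some GS | 1 => Some GCap | 2 => Some GCup | _ => None end.
Lemma gen_natK : pcancel gen_to_nat nat_to_gen. Proof. by case. Qed.
HB.instance Definition _ := Countable.copy gen (pcan_type gen_natK).

Definition src g := match g with GS => 2 | GCap => 2 | GCup => 0 end.
Definition tgt g := match g with GS => 2 | GCap => 0 | GCup => 2 end.
Definition gpar g : bool := match g with GS => false | _ => true end.

(* A layer (k, g, r) is the morphism 1_k (x) g (x) 1_r. *)
Definition layer := (nat * gen * nat)%type.
Definition dl : layer := (0, GS, 0).
Definition lsrc (l : layer) := let: (k, g, r) := l in k + src g + r.
Definition ltgt (l : layer) := let: (k, g, r) := l in k + tgt g + r.

(* A word [l_0; ...; l_n] is the diagram l_n o ... o l_0 (l_0 is applied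
   first, i.e. drawn at the bottom).  Composition v o u is u ++ v. *)
Definition word := seq layer.

Fixpoint wf (a b : nat) (w : word) : bool :=
  match w with
  | [::] => a == b
  | l :: w' => (lsrc l == a) && wf (ltgt l) b w'
  end.

Definition shl (n : nat) (w : word) : word :=
  [seq (n + l.1.1, l.1.2, l.2) | l <- w].
Definition shr (n : nat) (w : word) : word :=
  [seq (l.1.1, l.1.2, l.2 + n) | l <- w].

Section Free.
Variable F : fieldType.
Local Open Scope ring_scope.

Definition comb := seq (F * word).
Definition coef (x : comb) (w : word) : F := \sum_(p <- x | p.2 == w) p.1.
Definition scale (c : F) (x : comb) : comb := [seq (c * p.1, p.2) | p <- x].

(* generating relations: relations of a strict monoidal supercategory
   (super interchange of two disjoint layers) and (R1)-(R3) *)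
Inductive brel : nat -> nat -> comb -> Prop :=
| rel_ss : brel 2 2 [:: (1, [:: (0,GS,0); (0,GS,0)]); (-1, [::])]
| rel_braid : brel 3 3
    [:: (1, [:: (0,GS,1); (1,GS,0); (0,GS,1)]);
        (-1, [:: (1,GS,0); (0,GS,1); (1,GS,0)])]
| rel_zz1 : brel 1 1 [:: (1, [:: (1,GCup,0); (0,GCap,1)]); (1, [::])]
| rel_zz2 : brel 1 1 [:: (1, [:: (0,GCup,1); (1,GCap,0)]); (-1, [::])]
| rel_slide : brel 1 3
    [:: (1, [:: (0,GCup,1); (1,GS,0)]); (-1, [:: (1,GCup,0); (0,GS,1)])]
| rel_twist : brel 0 2
    [:: (1, [:: (0,GCup,0); (0,GS,0)]); (1, [:: (0,GCup,0)])]
| rel_interchange (k m r : nat) (h g : gen) :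
    brel (k + src h + m + src g + r) (k + tgt h + m + tgt g + r)
    [:: (1, [:: (k, h, m + src g + r); (k + tgt h + m, g, r)]);
        (- ((-1) ^+ (gpar h && gpar g)),
            [:: (k + src h + m, g, r); (k, h, m + tgt g + r)])].

(* the tensor ideal generated by the relations; ideal a b is a subspace of
   the free vector space on words a -> b *)
Inductive ideal : nat -> nat -> comb -> Prop :=
| id_rel a b x : brel a b x -> ideal a b x
| id_nil a b : ideal a b [::]
| id_add a b x y : ideal a b x -> ideal a b y -> ideal a b (x ++ y)
| id_scale a b c x : ideal a b x -> ideal a b (scale c x)
| id_ext a b x y : ideal a b x -> (forall w, coef x w = coef y w) -> ideal a b y
| id_pre a b c u x : wf c a u -> ideal a b x ->
    ideal c b [seq (p.1, u ++ p.2) | p <- x]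
| id_post a b c v x : wf b c v -> ideal a b x ->
    ideal a c [seq (p.1, p.2 ++ v) | p <- x]
| id_shl n a b x : ideal a b x -> ideal (n + a) (n + b) [seq (p.1, shl n p.2) | p <- x]
| id_shr n a b x : ideal a b x -> ideal (a + n) (b + n) [seq (p.1, shr n p.2) | p <- x].

End Free.

(* vertex (i, j) = j-th strand (from the left) at level i (level 0 = bottom,
   level size w = top); layer i goes from level i to level i+1. *)
Inductive edge (w : word) : nat * nat -> nat * nat -> Prop :=
| e_left i k g r j : i < size w -> nth dl w i = (k, g, r) -> j < k ->
    edge w (i, j) (i.+1, j)
| e_right i k g r j : i < size w -> nth dl w i = (k, g, r) ->
    k + src g <= j < k + src g + r -> edge w (i, j) (i.+1, j - src g + tgt g)
| e_cross1 i k r : i < size w -> nth dl w i = (k, GS, r) ->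
    edge w (i, k) (i.+1, k.+1)
| e_cross2 i k r : i < size w -> nth dl w i = (k, GS, r) ->
    edge w (i, k.+1) (i.+1, k)
| e_cap i k r : i < size w -> nth dl w i = (k, GCap, r) ->
    edge w (i, k) (i, k.+1)
| e_cup i k r : i < size w -> nth dl w i = (k, GCup, r) ->
    edge w (i.+1, k) (i.+1, k.+1).

(* two vertices lie on the same string *)
Definition linked (w : word) : relation (nat * nat) :=
  clos_refl_sym_trans _ (edge w).

Definition lvl (a : nat) (w : word) (i : nat) : nat :=
  if i is i'.+1 then ltgt (nth dl w i') else a.
Definition valid (a : nat) (w : word) (v : nat * nat) : Prop :=
  v.1 <= size w /\ v.2 < lvl a w v.1.

(* endpoints: inl j = j-th bottom point, inr j = j-th top point *)
Notation pt a b := ('I_a + 'I_b)%type.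
Definition pvert (a b : nat) (w : word) (p : pt a b) : nat * nat :=
  match p with inl j => (0, val j) | inr j => (size w, val j) end.

(* Conn(a,b): perfect matchings of the a+b endpoints, as fixed-point-free
   involutions *)
Definition is_matching (a b : nat) (f : {ffun pt a b -> pt a b}) : bool :=
  [forall x, (f (f x) == x) && (f x != x)].
Record conn (a b : nat) : predArgType := Conn {
  cval :> {ffun pt a b -> pt a b};
  cvalP : is_matching cval }.
HB.instance Definition _ a b := [isSub for @cval a b].
HB.instance Definition _ a b := [Finite of conn a b by <:].

Definition no_loops (a b : nat) (w : word) : Prop :=
  forall v, valid a w v -> exists p : pt a b, linked w v (pvert w p).

Definition has_conn (a b : nat) (w : word) (c : conn a b) : Prop :=
  forall p q : pt a b, p != q -> (c p = q <-> linked w (pvert w p) (pvert w q)).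

Definition gat (w : word) i := (nth dl w i).1.2.
Definition kat (w : word) i := (nth dl w i).1.1.

Definition leftend_bot (w : word) (v : nat * nat) (j : nat) : Prop :=
  linked w (0, j) v /\ forall j2, j2 < j -> ~ linked w (0, j2) v.
Definition leftend_top (w : word) (v : nat * nat) (j : nat) : Prop :=
  linked w (size w, j) v /\ forall j2, j2 < j -> ~ linked w (size w, j2) v.

Definition normal (w : word) : Prop :=
  (* no string intersects itself *)
  (forall i, i < size w -> gat w i = GS ->
     ~ linked w (i, kat w i) (i, (kat w i).+1)) /\
  (* two strings intersect at most once *)
  (forall i i', i < i' -> i' < size w -> gat w i = GS -> gat w i' = GS ->
     ~ ((linked w (i, kat w i) (i', kat w i') /\
         linked w (i, (kat w i).+1) (i', (kat w i').+1)) \/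
        (linked w (i, kat w i) (i', (kat w i').+1) /\
         linked w (i, (kat w i).+1) (i', kat w i')))) /\
  (* (no two cups/caps at the same height: automatic, one generator per layer) *)
  (forall i i', i < size w -> i' < size w -> gat w i = GCup -> gat w i' = GCap ->
     i' < i) /\
  (* heights of caps decrease from left to right (by left ends) *)
  (forall i i' j j', i < size w -> i' < size w -> gat w i = GCap -> gat w i' = GCap ->
     leftend_bot w (i, kat w i) j -> leftend_bot w (i', kat w i') j' -> j < j' ->
     i' < i) /\
  (* heights of cups increase from left to right (by left ends) *)
  (forall i i' j j', i < size w -> i' < size w -> gat w i = GCup -> gat w i' = GCup ->
     leftend_top w (i.+1, kat w i) j -> leftend_top w (i'.+1, kat w i') j' -> j < j' ->
     i < i').

Fixpoint dfact (n : nat) : nat :=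
  match n with 0 => 1 | 1 => 1 | (m.+2) as n' => n' * dfact m end.

(* Main.v *)
Require Import Defs.
From HB Require Import structures.
From mathcomp Require Import all_boot all_order all_algebra.
From mathcomp Require Import zify ring.
From Stdlib Require Import Relations.
Set Implicit Arguments. Unset Strict Implicit. Unset Printing Implicit Defensive.
Import GRing.Theory.

(** Spanning.  Bending strands reduces Hom(a,b) to Hom(0,a+b).  There, every
    diagram is, up to a scalar, a composite of arcs, each of which joins the
    leftmost point to some other point; these composites are counted by
    (a+b-1)!!.  All rewriting is done up to unspecified scalars.  The only sign
    that matters is the one in b o s = b, which together with s o b^* = - b^*
    kills loops; it is read off from the representation below.

    Independence.  sBr acts on the tensor powers of the superspace with basis
    C x {even, odd} carrying an odd form that pairs (i, even) with (i, odd).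
    Matrix coefficients are state sums over labellings of the strings.  Colouring
    the two ends of each string of c by a colour of its own singles out c: for
    another connector there is no compatible labelling, and for c there is exactly
    one, because without loops the labels at the end points determine all others.
    Its existence requires orienting the strings consistently; a forward rewriting
    step can be undone on orientations, so it is enough to orient the standard
    diagrams.

    Hence the diagrams d_c are nonzero multiples of distinct standard diagrams,
    and since both families have the same size, they span as well. *)

(** * The representation *)

Section Representation.
Variables (F : fieldType) (C : finType).
Local Open Scope ring_scope.
Notation L := (C * bool)%type.

Definition dual (u : L) : L := (u.1, ~~ u.2).
Definition par (x : seq L) : bool := foldr (fun u b => u.2 (+) b) false x.
Definition sg (b : bool) : F := (-1) ^+ b.

Lemma par_cat x y : par (x ++ y) = par x (+) par y.
Proof. by elim: x => //= u x ->; rewrite addbA. Qed.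

Lemma sgD b c : sg (b (+) c) = sg b * sg c.
Proof. by rewrite /sg signr_addb. Qed.

(* Pull-back of functions along a layer: (1_k (x) g (x) 1_r) x is the combination
   of labellings z on which [phi] is evaluated.  [e] is the parity of whatever
   stands further to the left; an odd g picks up the sign of everything it passes. *)
Definition act_layer (e : bool) (l : layer) (phi : seq L -> F) (x : seq L) : F :=
  let: (k, g, r) := l in
  if size x != (k + src g + r)%N then 0 else
  let p := take k x in
  match g, drop k x with
  | GS, u :: v :: q => sg (u.2 && v.2) * phi (p ++ v :: u :: q)
  | GCap, u :: v :: q =>
      if v == dual u then sg (e (+) par p) * phi (p ++ q) else 0
  | GCup, q => sg (e (+) par p) * \sum_u sg u.2 * phi (p ++ u :: dual u :: q)
  | _, _ => 0
  end.

Arguments act_layer : simpl never.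

Fixpoint act (e : bool) (w : word) (phi : seq L -> F) : seq L -> F :=
  if w is l :: w' then act_layer e l (act e w' phi) else phi.

Lemma eq_act_layer e l phi psi : phi =1 psi ->
  act_layer e l phi =1 act_layer e l psi.
Proof.
move=> h x; case: l => [[k g] r]; rewrite /act_layer; case: eqP => //= _.
case: g; case: (drop k x) => [|u [|v q]] //=; rewrite ?h //; last 3 first.
- by congr (_ * _); apply: eq_bigr => u0 _; rewrite h.
- by congr (_ * _); apply: eq_bigr => u0 _; rewrite h.
- by congr (_ * _); apply: eq_bigr => u0 _; rewrite h.
Qed.

Lemma act_cons e l w phi : act e (l :: w) phi = act_layer e l (act e w phi).
Proof. by []. Qed.

Lemma act_cat e u v phi : act e (u ++ v) phi = act e u (act e v phi).
Proof. by elim: u => //= l u ->. Qed.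

(** Only the middle block changes; the labels to its left matter for the sign only, through their
    parity. *)
Lemma act_layer_local e k g r phi p X q : size p = k -> size q = r ->
  act_layer e (k, g, r) phi (p ++ X ++ q) =
  act_layer (e (+) par p) (0%N, g, 0%N) (fun Z => phi (p ++ Z ++ q)) X.
Proof.
move=> hp hq; rewrite /act_layer !size_cat hp hq addnA eqn_add2r eqn_add2l.
rewrite add0n addn0 take0 drop0 addbF /=.
have -> : take k (p ++ X ++ q) = p by rewrite -hp take_size_cat.
have -> : drop k (p ++ X ++ q) = X ++ q by rewrite -hp drop_size_cat.
case: g => /=; case: X => [|u [|v [|? X]]] //=.
Qed.

(** Strands added on the left stay fixed and contribute a sign through their parity; the argument
    [e] exists to carry it. *)
Lemma act_shl n e w phi x1 x2 : size x1 = n ->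
  act e (shl n w) phi (x1 ++ x2) =
  act (e (+) par x1) w (fun z => phi (x1 ++ z)) x2.
Proof.
move=> h1; elim: w x2 => [|[[k g] r] w IH] x2 //.
change (shl n _) with ((n + k, g, r) :: shl n w)%N; rewrite !act_cons.
case: (boolP (size x2 == k + src g + r)%N) => hs; last first.
  have hs' : size (x1 ++ x2) != (n + k + src g + r)%N by rewrite size_cat; lia.
  by rewrite /act_layer hs hs' /=.
have [X [Y [-> hX hY]]] : exists X Y, [/\ x2 = X ++ Y ++ drop (k + src g) x2,
   size X = k & size Y = src g].
  exists (take k x2), (take (src g) (drop k x2)); split.
  - by rewrite addnC -drop_drop !cat_take_drop.
  - by rewrite size_take; case: ifP; lia.
  - by rewrite size_take size_drop; case: ifP; lia.
set Q := drop _ x2; have hQ : size Q = r by rewrite size_drop; lia.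
rewrite catA act_layer_local ?size_cat ?h1 ?hX //.
rewrite [RHS]act_layer_local // par_cat addbA.
by apply: eq_act_layer => Z; rewrite -catA IH.
Qed.

Lemma act_shr n e w phi x1 x2 : size x2 = n ->
  act e (shr n w) phi (x1 ++ x2) = act e w (fun z => phi (z ++ x2)) x1.
Proof.
move=> h1; elim: w x1 => [|[[k g] r] w IH] x1 //.
change (shr n _) with ((k, g, r + n) :: shr n w)%N; rewrite !act_cons.
case: (boolP (size x1 == k + src g + r)%N) => hs; last first.
  have hs' : size (x1 ++ x2) != (k + src g + (r + n))%N by rewrite size_cat; lia.
  by rewrite /act_layer hs hs' /=.
have [X [Y [-> hX hY]]] : exists X Y, [/\ x1 = X ++ Y ++ drop (k + src g) x1,
   size X = k & size Y = src g].
  exists (take k x1), (take (src g) (drop k x1)); split.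
  - by rewrite addnC -drop_drop !cat_take_drop.
  - by rewrite size_take; case: ifP; lia.
  - by rewrite size_take size_drop; case: ifP; lia.
set Q := drop _ x1; have hQ : size Q = r by rewrite size_drop; lia.
rewrite -!catA act_layer_local ?size_cat ?h1 ?hX ?hQ //.
rewrite [RHS]act_layer_local //.
by apply: eq_act_layer => Z; rewrite -IH -!catA.
Qed.

(** * Linear extension from words to formal combinations *)

Definition eval (G : word -> F) (x : comb F) : F := \sum_(p <- x) p.1 * G p.2.

(** Grouping equal words gives the sum of [coef] times [G] over distinct words, so evaluation
    descends to the free vector space. *)
Lemma eval_coef G x y : (forall w, coef x w = coef y w) -> eval G x = eval G y.
Proof.
move=> h.
have E (z : comb F) (s : seq word) : uniq s -> {subset [seq p.2 | p <- z] <= s} ->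
    eval G z = \sum_(w <- s) coef z w * G w.
  move=> us hz; rewrite /coef; under eq_bigr do rewrite big_distrl /=.
  rewrite (exchange_big_dep predT) //= /eval; apply: eq_big_seq => p hp.
  rewrite (eq_bigl (fun w => w == p.2)); last by move=> w; rewrite eq_sym.
  rewrite -big_filter; have -> : [seq w <- s | w == p.2] = [:: p.2].
    by rewrite filter_pred1_uniq //; apply: hz; apply: map_f.
  by rewrite big_seq1.
set s := undup ([seq p.2 | p <- x] ++ [seq p.2 | p <- y]).
rewrite (E x s) ?(E y s) ?undup_uniq //; last 2 first.
- by move=> w hw; rewrite mem_undup mem_cat hw orbT.
- by move=> w hw; rewrite mem_undup mem_cat hw.
by apply: eq_bigr => w _; rewrite h.
Qed.

Lemma eval_map G f (x : comb F) :
  eval G [seq (p.1, f p.2) | p <- x] = eval (G \o f) x.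
Proof. by rewrite /eval big_map. Qed.

Lemma act_eval e u (psi : word -> seq L -> F) (x : comb F) y :
  eval (fun w => act e u (psi w) y) x =
  act e u (fun z => eval (fun w => psi w z) x) y.
Proof.
elim: u y => [|[[k g] r] u IH] y //=.
transitivity (act_layer e (k, g, r)
   (fun z => eval (fun w => act e u (psi w) z) x) y); last exact: eq_act_layer.
rewrite /act_layer /eval; case: eqP => /= _; last by rewrite big1 // => *; rewrite mulr0.
have H c (f : F * word -> F) (g0 : word -> F) : (forall p, f p = c * (p.1 * g0 p.2)) ->
   \sum_(p <- x) f p = c * \sum_(p <- x) p.1 * g0 p.2.
  by move=> h; rewrite big_distrr; apply: eq_bigr => p _; rewrite h.
have H2 c q (f := fun w u0 => act e u (psi w) (take k y ++ u0 :: dual u0 :: q)) :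
    \sum_(p <- x) p.1 * (c * \sum_u0 sg u0.2 * f p.2 u0) =
    c * \sum_u0 sg u0.2 * \sum_(p <- x) p.1 * f p.2 u0.
  rewrite (eq_bigr (fun u0 => \sum_(p <- x) sg u0.2 * (p.1 * f p.2 u0))); last first.
    by move=> u0 _; rewrite big_distrr.
  rewrite exchange_big /= big_distrr /=; apply: eq_bigr => p _.
  rewrite mulrCA; congr (_ * _); rewrite big_distrr.
  by apply: eq_bigr => ? _; rewrite /= mulrCA.
case: g; case: (drop k y) => [|u0 [|v q]] //=; rewrite ?H2 //.
- by rewrite big1 // => *; rewrite mulr0.
- by rewrite big1 // => *; rewrite mulr0.
- by apply: (H _ _ (fun w => act e u (psi w) _)) => p; rewrite mulrCA.
- by rewrite big1 // => *; rewrite mulr0.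
- by rewrite big1 // => *; rewrite mulr0.
- case: eqP => _; last by rewrite big1 // => *; rewrite mulr0.
  by apply: (H _ _ (fun w => act e u (psi w) _)) => p; rewrite mulrCA.
Qed.

(** * Signs of single layers and verification of the relations *)

Lemma eval2 G (a b : F) u v : eval G [:: (a, u); (b, v)] = a * G u + b * G v.
Proof. by rewrite /eval !big_cons big_nil addr0. Qed.

Lemma dualK : involutive dual.
Proof. by case=> c b; rewrite /dual /= negbK. Qed.

Lemma sum_pick (t : L) (f g : L -> F) :
  \sum_v g v * (if v == t then f v else 0) = g t * f t.
Proof.
rewrite (bigD1 t) //= eqxx big1 ?addr0 // => v /negbTE ->; exact: mulr0.
Qed.

Lemma sgb b : sg b * sg b = 1. Proof. by rewrite -sgD addbb. Qed.
Lemma sgN b : sg (~~ b) = - sg b.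
Proof. by case: b; rewrite /sg /= ?opprK ?expr0 ?expr1 ?opprK. Qed.

(** A generator is homogeneous: it evaluates its argument only at labellings whose parity differs
    from that of the input by [gpar g]. *)
Lemma act_layer_scale e g phi psi X d :
  (forall Z, size Z = tgt g -> par Z = par X (+) gpar g -> phi Z = d * psi Z) ->
  act_layer e (0%N, g, 0%N) phi X = d * act_layer e (0%N, g, 0%N) psi X.
Proof.
rewrite /act_layer; case: eqP => /= [hs|_ _]; last by rewrite mulr0.
rewrite drop0 take0 addn0 in hs *.
case: g hs.
- case: X => [|u [|v []]] // _ h; rewrite h /= ?addbF //; last by rewrite addbC.
  exact: mulrCA.
- case: X => [|u [|v []]] //= _ h.
  case: eqP h => [->|_ _]; last by rewrite mulr0.
  by move=> h; rewrite h 1?mulrCA //=; case: u.2.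
- case: X => // _ h; rewrite mulrCA; congr (_ * _); rewrite big_distrr.
  by apply: eq_bigr => u _ /=; rewrite h 1?mulrCA //=; case: u.2.
Qed.

Lemma eq_act_layer_in e g phi psi X :
  (forall Z, size Z = tgt g -> phi Z = psi Z) ->
  act_layer e (0%N, g, 0%N) phi X = act_layer e (0%N, g, 0%N) psi X.
Proof.
by move=> h; rewrite -[RHS]mul1r; apply: act_layer_scale => Z hZ _; rewrite h ?mul1r.
Qed.

(** The layers act on separate variables with their outer parities held fixed, so no sign appears;
    the interchange sign comes from [act_layer_sign]. *)
Lemma act_layerC e1 e2 h g (phi : seq L -> seq L -> F) X Y :
  act_layer e1 (0%N, h, 0%N)
    (fun Z => act_layer e2 (0%N, g, 0%N) (fun W => phi Z W) Y) X =
  act_layer e2 (0%N, g, 0%N)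
    (fun W => act_layer e1 (0%N, h, 0%N) (fun Z => phi Z W) X) Y.
Proof.
rewrite /act_layer; do 2!case: eqP => /= _ //; last 2 first.
- case: h; rewrite ?drop0; case: X => [|u [|v q]] //=; rewrite ?mulr0 ?if_same //.
  + by rewrite big1 ?mulr0 // => *; rewrite mulr0.
  + by rewrite big1 ?mulr0 // => *; rewrite mulr0.
  + by rewrite big1 ?mulr0 // => *; rewrite mulr0.
- case: g; rewrite ?drop0; case: Y => [|u [|v q]] //=; rewrite ?mulr0 ?if_same //.
  + by rewrite big1 ?mulr0 // => *; rewrite mulr0.
  + by rewrite big1 ?mulr0 // => *; rewrite mulr0.
  + by rewrite big1 ?mulr0 // => *; rewrite mulr0.
rewrite !drop0 !take0.
case: h.
{ case: X => [|u [|v q]]; case: g; case: Y => [|s [|t z]] //=;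
    rewrite ?mulr0 ?if_same //.
  all: try by rewrite big1 ?mulr0 // => *; rewrite mulr0.
  all: try by case: eqP => _; rewrite ?mulr0 // mulrCA.
  1: by ring.
  all: rewrite mulrCA; congr (_ * _); rewrite big_distrr.
  all: by apply: eq_bigr => * /=; ring. }
{ case: X => [|u [|v q]]; case: g; case: Y => [|s [|t z]] //=;
    rewrite ?mulr0 ?if_same //.
  all: try by rewrite big1 ?mulr0 // => *; rewrite mulr0.
  all: case: (v == dual u); rewrite ?mulr0 ?if_same //.
  all: try by rewrite big1 ?mulr0 // => *; rewrite mulr0.
  + by ring.
  + by case: eqP => _; rewrite ?mulr0 // mulrCA.
  all: rewrite mulrCA; congr (_ * _); rewrite big_distrr.
  all: by apply: eq_bigr => * /=; ring. }
- case: g.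
  + case: Y => [|s [|t z]] //=; rewrite ?mulr0 ?if_same //.
    1,2: by rewrite big1 ?mulr0 // => *; rewrite mulr0.
    rewrite [RHS]mulrCA; congr (_ * _); rewrite big_distrr.
    by apply: eq_bigr => * /=; ring.
  + case: Y => [|s [|t z]] //=; rewrite ?mulr0 ?if_same //.
    1,2: by rewrite big1 ?mulr0 // => *; rewrite mulr0.
    case: eqP => _; last by rewrite big1 ?mulr0 // => *; rewrite mulr0.
    rewrite [RHS]mulrCA; congr (_ * _); rewrite big_distrr.
    by apply: eq_bigr => * /=; ring.
  + transitivity (\sum_u \sum_v sg (e1 (+) par [::]) * sg u.2 *
       (sg (e2 (+) par [::]) * sg v.2 * phi (u :: dual u :: X) (v :: dual v :: Y))).
      rewrite big_distrr; apply: eq_bigr => u _ /=; rewrite mulrA -big_distrr /=.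
      by congr (_ * _); rewrite big_distrr; apply: eq_bigr => v _; rewrite /= mulrA.
    rewrite exchange_big big_distrr; apply: eq_bigr => v _ /=.
    by rewrite mulrA !big_distrr; apply: eq_bigr => u _ /=; ring.
Qed.

Lemma act_layer_sign e d g phi X :
  act_layer (e (+) d) (0%N, g, 0%N) phi X =
  sg (gpar g && d) * act_layer e (0%N, g, 0%N) phi X.
Proof.
rewrite /act_layer; case: eqP => /= _; last by rewrite mulr0.
case: g; case: (drop 0 X) => [|u [|v q]] //=;
  rewrite ?mulr0 ?mul1r ?[e (+) d]addbC -?addbA ?sgD -?mulrA //.
all: try by rewrite /sg expr0 mul1r.
by case: eqP => _; rewrite ?mulr0 //.
Qed.

(** Relations are shown to vanish on inputs of the right length; this carries the vanishing through
    a diagram applied before them. *)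
Lemma act_wf_eq0 e a b u phi y : wf a b u -> size y = a ->
  (forall z, size z = b -> phi z = 0) -> act e u phi y = 0.
Proof.
move=> wu hy h; elim: u a y wu hy => [|[[k g] r] u IH] a y /=.
  by move=> /eqP eb ey; apply: h; rewrite -eb.
case/andP=> /eqP <- wu hy.
have [X [Y [Z [-> hX hY hZ]]]] : exists X Y Z, [/\ y = X ++ Y ++ Z,
   size X = k, size Y = src g & size Z = r].
  exists (take k y), (take (src g) (drop k y)), (drop (src g) (drop k y)).
  by rewrite !cat_take_drop !size_take !size_drop; split=> //; try case: ifP; lia.
rewrite [LHS]act_layer_local // -[RHS](mul0r (act_layer (e (+) par X) (0, g, 0)%N (fun=> 0) Y)).
by apply: act_layer_scale => W hW _; rewrite mul0r (IH _ _ wu) // !size_cat hX hW hZ addnA.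
Qed.

Lemma act_brel a b x : brel a b x -> forall e phi y, size y = a ->
  eval (fun w => act e w phi y) x = 0.
Proof.
case.
- move=> e phi [|u [|v []]] //= _; rewrite eval2 /act /act_layer /=.
  by rewrite [v.2 && u.2]andbC mul1r mulrA sgb; ring.
- move=> e phi [|u [|v [|t []]]] //= _; rewrite eval2 /act /act_layer /=.
  by rewrite mulN1r; apply/eqP; rewrite subr_eq0; apply/eqP; ring.
- move=> e phi [|u []] //= _; rewrite eval2 /act /act_layer /=.
  (* The cap selects the label [dual u], whose sign [- sg u.2] produces the minus in the first
     zigzag relation. *)
  rewrite (sum_pick (dual u) (fun v => sg (e (+) false) * phi [:: dual v]) (fun v => sg v.2)).
  rewrite dualK /= !addbF sgD sgN.
  have := sgb u.2; have := sgb e; move: (sg e) (sg u.2) => A B hA hB.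
  by ring: hA hB.
- move=> e phi [|u []] //= _; rewrite eval2 /act /act_layer /=.
  under eq_bigr => v _ do rewrite dualK eq_sym.
  rewrite (sum_pick u (fun v => sg (e (+) (v.2 (+) false)) * phi [:: v]) (fun v => sg v.2)).
  rewrite /= !addbF sgD.
  have := sgb u.2; have := sgb e; move: (sg e) (sg u.2) => A B hA hB.
  by ring: hA hB.
- move=> e phi [|u []] //= _; rewrite eval2 /act /act_layer /=.
  rewrite addbF mul1r mulN1r; apply/eqP; rewrite subr_eq0; apply/eqP.
  rewrite addbF sgD -mulrA; congr (_ * _); rewrite big_distrr /=.
  apply: eq_bigr => v _; rewrite /sg.
  by case: u => ? []; case: v => ? [] /=; ring.
- move=> e phi [|] //= _; rewrite eval2 /act /act_layer /= !mul1r -mulrDr.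
  (* Reindexing by [dual] flips the sign in the cup, while crossing an even and an odd label costs
     no sign. *)
  rewrite (reindex_inj (can_inj dualK)) /= -big_split big1 ?mulr0 // => v _ /=.
  by rewrite dualK /sg; case: v => ? [] /=; ring.
- move=> k m r h g e phi y hy.
  have [p [X [M [Y [q [-> [h1 h2 h3 h4 h5]]]]]]] : exists p X M Y q,
     y = p ++ X ++ M ++ Y ++ q /\ [/\ size p = k, size X = src h, size M = m,
       size Y = src g & size q = r].
    exists (take k y), (take (src h) (drop k y)), (take m (drop (src h) (drop k y))),
      (take (src g) (drop m (drop (src h) (drop k y)))), 
      (drop (src g) (drop m (drop (src h) (drop k y)))).
    rewrite !cat_take_drop; split=> //.
    by rewrite !size_take !size_drop; split; try case: ifP; lia.
  have nD (i j : nat) : (i + j)%R = (i + j)%N by [].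
  rewrite eval2 !act_cons !nD.
  have -> : p ++ X ++ M ++ Y ++ q = (p ++ X ++ M) ++ Y ++ q by rewrite -!catA.
  rewrite [X in _ + _ * X]act_layer_local ?size_cat ?h1 ?h2 ?h3 ?addnA //.
  have -> : (p ++ X ++ M) ++ Y ++ q = p ++ X ++ (M ++ Y ++ q) by rewrite -!catA.
  rewrite act_layer_local ?size_cat ?h3 ?h4 ?h5 ?addnA //.
  set A := act_layer _ _ _ X; set B := act_layer _ _ _ Y.
  suff -> : A = sg (gpar h && gpar g) * B by rewrite /sg; ring.
  rewrite /A /B {A B}.
  pose e1 := e (+) par p; pose e2 := e (+) par (p ++ X ++ M).
  pose phi' Z W := phi (p ++ Z ++ M ++ W ++ q).
  transitivity (sg (gpar h && gpar g) * act_layer e1 (0, h, 0)%N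
      (fun Z => act_layer e2 (0, g, 0)%N (phi' Z) Y) X).
    apply: act_layer_scale => Z hZ pZ.
    have -> : p ++ Z ++ M ++ Y ++ q = (p ++ Z ++ M) ++ Y ++ q by rewrite -!catA.
    rewrite act_layer_local ?size_cat ?h1 ?hZ ?h3 ?addnA //.
    (* Applying [h] first changes the parity to the left of [g] by [gpar h]: this is the super
       interchange sign. *)
    have -> : e (+) par (p ++ Z ++ M) = e2 (+) gpar h.
      by rewrite /e2 !par_cat pZ -!addbA; congr (_ (+) (_ (+) (_ (+) _))); rewrite addbC.
    rewrite act_layer_sign andbC; congr (_ * _); apply: eq_act_layer => W.
    by rewrite /phi' -!catA.
  congr (_ * _); rewrite act_layerC; apply: eq_act_layer_in => W hW.
  have -> : (p ++ X ++ M) ++ W ++ q = p ++ X ++ (M ++ W ++ q) by rewrite -!catA.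
  by rewrite act_layer_local ?size_cat ?h3 ?hW ?h5 ?addnA.
Qed.

(** The quantifiers over [e] and [phi] serve the induction: tensoring on the left changes [e],
    composing on top or tensoring replaces [phi]. *)
Lemma act_ideal a b x : ideal a b x -> forall e phi y, size y = a ->
  eval (fun w => act e w phi y) x = 0.
Proof.
elim=> {a b x}.
- exact: act_brel.
- by move=> a b e phi y _; rewrite /eval big_nil.
- move=> a b x y _ IHx _ IHy e phi z hz.
  move: (IHx e phi z hz) (IHy e phi z hz).
  by rewrite /eval big_cat /= => -> ->; rewrite addr0.
- move=> a b c x _ IH e phi y hy; rewrite /eval big_map /=.
  under eq_bigr do rewrite -mulrA.
  by rewrite -big_distrr /=; move: (IH e phi y hy); rewrite /eval => ->; rewrite mulr0.
- by move=> a b x y _ IH h e phi z hz; rewrite -(eval_coef _ h); apply: IH.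
- move=> a b c u x wu _ IH e phi y hy; rewrite (eval_map _ (cat u)) /comp.
  transitivity (eval (fun w => act e u (act e w phi) y) x).
    by apply: eq_bigr => p _; rewrite act_cat.
  rewrite act_eval; apply: act_wf_eq0 wu hy _ => z hz; exact: IH.
- move=> a b c u x wu _ IH e phi y hy; rewrite (eval_map _ (cat^~ u)) /comp.
  transitivity (eval (fun w => act e w (act e u phi) y) x).
    by apply: eq_bigr => p _; rewrite act_cat.
  exact: IH.
- move=> n a b x _ IH e phi y hy; rewrite (eval_map _ (shl n)) /comp.
  transitivity (eval (fun w => act (e (+) par (take n y)) w
      (fun z => phi (take n y ++ z)) (drop n y)) x).
    apply: eq_bigr => p _; rewrite -{1}(cat_take_drop n y) act_shl //.
    by rewrite size_take; case: ifP; lia.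
  by apply: IH; rewrite size_drop; lia.
- move=> n a b x _ IH e phi y hy; rewrite (eval_map _ (shr n)) /comp.
  transitivity (eval (fun w => act e w
      (fun z => phi (z ++ drop a y)) (take a y)) x).
    by apply: eq_bigr => p _; rewrite -{1}(cat_take_drop a y) act_shr // size_drop; lia.
  by apply: IH; rewrite size_take; case: ifP; lia.
Qed.
End Representation.

Arguments act_layer : simpl never.

(** * Words without right padding *)

(** The right padding is determined by the number of incoming strands. Without it, adding a strand
    on the right leaves the word unchanged. *)
Definition rword := seq (nat * gen).

Definition step n g := n - src g + tgt g.

Fixpoint el (n : nat) (u : rword) : word :=
  if u is (k, g) :: u' then (k, g, n - (k + src g)) :: el (step n g) u' else [::].
Fixpoint ok (n : nat) (u : rword) : bool :=
  if u is (k, g) :: u' then (k + src g <= n) && ok (step n g) u' else true.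
Fixpoint out (n : nat) (u : rword) : nat :=
  if u is (k, g) :: u' then out (step n g) u' else n.

Lemma el_cat n u v : el n (u ++ v) = el n u ++ el (out n u) v.
Proof. by elim: u n => [|[k g] u IH] n //=; rewrite IH. Qed.
Lemma ok_cat n u v : ok n (u ++ v) = ok n u && ok (out n u) v.
Proof. by elim: u n => [|[k g] u IH] n //=; rewrite IH andbA. Qed.
Lemma out_cat n u v : out n (u ++ v) = out (out n u) v.
Proof. by elim: u n => [|[k g] u IH] n //=; rewrite IH. Qed.

Lemma el_wf n u : ok n u -> wf n (out n u) (el n u).
Proof.
elim: u n => [|[k g] u IH] n /=; first by rewrite eqxx.
case/andP=> hk /IH h; apply/andP; split; first by lia.
by have -> : k + tgt g + (n - (k + src g)) = step n g by rewrite /step; lia.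
Qed.

Lemma wf_el n m w : wf n m w ->
  [/\ ok n (map fst w), out n (map fst w) = m & el n (map fst w) = w].
Proof.
elim: w n => [|[[k g] r] w IH] n /=; first by move/eqP.
case/andP=> /eqP <-.
have -> : k + tgt g + r = step (k + src g + r) g by rewrite /step; lia.
case/IH => h1 h2 h3; rewrite h1 h2 h3; split=> //; first by lia.
by congr ((_, _, _) :: _); lia.
Qed.

(** The defining relations and the interchange law at an arbitrary position, with scalars dropped;
    only [base_zz1], [base_twist] and [base_int] hide a sign. *)
Inductive base (n : nat) : rword -> rword -> Prop :=
| base_ss k : k.+2 <= n -> base n [:: (k, GS); (k, GS)] [::]
| base_braid k : k.+3 <= n ->
    base n [:: (k, GS); (k.+1, GS); (k, GS)] [:: (k.+1, GS); (k, GS); (k.+1, GS)]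
| base_zz1 k : k.+1 <= n -> base n [:: (k.+1, GCup); (k, GCap)] [::]
| base_zz2 k : k.+1 <= n -> base n [:: (k, GCup); (k.+1, GCap)] [::]
| base_slide k : k.+1 <= n ->
    base n [:: (k, GCup); (k.+1, GS)] [:: (k.+1, GCup); (k, GS)]
| base_twist k : k <= n -> base n [:: (k, GCup); (k, GS)] [:: (k, GCup)]
| base_int k h j g : k + src h + j + src g <= n ->
    base n [:: (k, h); (k + tgt h + j, g)] [:: (k + src h + j, g); (k, h)].

(* Rewriting up to nonzero scalars; for [L = true] it may also delete a loop,
   which multiplies the diagram by zero. *)
Inductive mv (L : bool) : nat -> rword -> rword -> Prop :=
| mv_refl n u : mv L n u u
| mv_trans n u v w : mv L n u v -> mv L n v w -> mv L n u w
| mv_base n p u v q : base (out n p) u v -> mv L n (p ++ u ++ q) (p ++ v ++ q)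
| mv_base_sym n p u v q : base (out n p) u v -> mv L n (p ++ v ++ q) (p ++ u ++ q)
| mv_loop n p k q : L -> k <= out n p ->
    mv L n (p ++ [:: (k, GCup); (k, GCap)] ++ q) (p ++ q).

Lemma mv_ctx L n p u v q : mv L (out n p) u v -> mv L n (p ++ u ++ q) (p ++ v ++ q).
Proof.
move En: (out n p) => n' h; elim: h En => {n' u v}.
- by move=> *; exact: mv_refl.
- by move=> n' u v w _ IH1 _ IH2 h; apply: mv_trans (IH1 h) (IH2 h).
- move=> n' p' u v q' h E; rewrite -!catA !(catA p); apply: mv_base.
  by rewrite out_cat E.
- move=> n' p' u v q' h E; rewrite -!catA !(catA p); apply: mv_base_sym.
  by rewrite out_cat E.
- move=> n' p' k q' hL h E; rewrite -!catA !(catA p); apply: mv_loop => //.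
  by rewrite out_cat E.
Qed.

Lemma mv_pre L n p u v : mv L (out n p) u v -> mv L n (p ++ u) (p ++ v).
Proof. by move=> h; have := mv_ctx [::] h; rewrite !cats0. Qed.
Lemma mv_post L n u v q : mv L n u v -> mv L n (u ++ q) (v ++ q).
Proof. exact: (@mv_ctx L n [::]). Qed.

Lemma base_ok n u v : base n u v -> [/\ ok n u, ok n v & out n u = out n v].
Proof. by case=> *; rewrite /= /step /=; split=> //; lia. Qed.

Lemma mv_ok L n u v : mv L n u v -> ok n u -> ok n v /\ out n v = out n u.
Proof.
elim=> {n u v}; rewrite //.
- by move=> n u v w _ IH1 _ IH2 /IH1[/IH2[-> ->] ->].
- move=> n p u v q /base_ok[h1 h2 h3]; rewrite !ok_cat !out_cat h3 h1 h2 /=.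
  by case/andP=> -> ->.
- move=> n p u v q /base_ok[h1 h2 h3]; rewrite !ok_cat !out_cat h3 h1 h2 /=.
  by case/andP=> -> ->.
- move=> n p k q _ hk; rewrite !ok_cat !out_cat /= /step /=.
  have -> : out n p - 0 + 2 - 2 + 0 = out n p by lia.
  by case/andP=> -> /andP[_ ->].
Qed.

Lemma base_S n u v : base n u v -> base n.+1 u v.
Proof. by case=> *; constructor; lia. Qed.

Lemma out_S n u : ok n u -> out n.+1 u = (out n u).+1.
Proof.
elim: u n => [|[k g] u IH] n //= /andP[h /IH <-].
by congr (out _ _); rewrite /step; lia.
Qed.

Lemma ok_S n u : ok n u -> ok n.+1 u.
Proof.
elim: u n => [|[k g] u IH] n //= /andP[h /IH].
have -> : (step n g).+1 = step n.+1 g by rewrite /step; lia.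
by move=> ->; rewrite andbT; lia.
Qed.

(** Validity of [u] keeps the truncated subtraction in [step] exact, so every intermediate strand
    count grows by one. *)
Lemma mv_S L n u v : ok n u -> mv L n u v -> mv L n.+1 u v.
Proof.
move=> + h; elim: h => {n u v}.
- by move=> *; exact: mv_refl.
- move=> n u v w h1 IH1 h2 IH2 hu; apply: mv_trans (IH1 hu) _.
  by apply: IH2; case: (mv_ok h1 hu).
- move=> n p u v q h; rewrite ok_cat => /andP[hp _]; apply: mv_base.
  by rewrite out_S //; apply: base_S.
- move=> n p u v q h; rewrite ok_cat => /andP[hp _]; apply: mv_base_sym.
  by rewrite out_S //; apply: base_S.
- move=> n p k q hL h; rewrite ok_cat => /andP[hp _]; apply: mv_loop => //.
  by rewrite out_S // ltnW.
Qed.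

Lemma mvb L n u v : base n u v -> mv L n u v.
Proof. by move=> h; have := @mv_base L n [::] u v [::] h; rewrite /= !cats0. Qed.
Lemma mvbs L n u v : base n u v -> mv L n v u.
Proof. by move=> h; have := @mv_base_sym L n [::] u v [::] h; rewrite /= !cats0. Qed.

(** * State sequences *)

Section Chains.
Variables (X : Type) (du : X -> X).
Hypothesis duK : involutive du.

(** Compatibility of labels [x] below and [z] above a layer, where [du] exchanges the two ends of an
    arc. With [negb] this describes orientations, with [dual] the support of matrix coefficients. *)
Fixpoint lrel (k : nat) (g : gen) (x z : seq X) : Prop :=
  match k with
  | 0 => match g with
         | GS => exists a b q, x = [:: a, b & q] /\ z = [:: b, a & q]
         | GCap => exists a, x = [:: a, du a & z]
         | GCup => exists a, z = [:: a, du a & x]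
         end
  | k'.+1 => match x, z with
             | a :: x', b :: z' => a = b /\ lrel k' g x' z'
             | _, _ => False
             end
  end.

Fixpoint rch (u : rword) (x y : seq X) : Prop :=
  if u is (k, g) :: u' then exists z, lrel k g x z /\ rch u' z y else x = y.

Lemma rch_cat u v x y : rch (u ++ v) x y <-> exists z, rch u x z /\ rch v z y.
Proof.
elim: u x => [|[k g] u IH] x /=.
  by split; [exists x | case=> z [<-]].
split=> [[z [h /IH[t [h1 h2]]]]|[t [[z [h1 h2]] h3]]].
  by exists t; split=> //; exists z.
by exists z; split=> //; apply/IH; exists t.
Qed.

Lemma lrel_size k g x z : lrel k g x z ->
  k + src g <= size x /\ size z = step (size x) g.
Proof.
rewrite /step; elim: k x z => [|k IH] x z /=.
- case: g => [[a [b [q [-> ->]]]]|[a ->]|[a ->]] /=; lia.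
- by case: x => // a x; case: z => // b z [_ /IH] /=; lia.
Qed.

Lemma lrel_cat p g x z : lrel (size p) g (p ++ x) (p ++ z) <-> lrel 0 g x z.
Proof. by elim: p => [|a p IH] //=; rewrite IH; split=> [[]|]. Qed.

Definition sh1 (u : rword) : rword := [seq (l.1.+1, l.2) | l <- u].

Lemma rch_sh1 u a x y : rch (sh1 u) (a :: x) y <-> exists y', y = a :: y' /\ rch u x y'.
Proof.
elim: u x y => [|[k g] u IH] x y /=.
  by split=> [<-|[y' [-> <-]]] //; exists x.
rewrite -/(sh1 u); split.
- case=> z [hz hr]; case: z hz hr => [//|b z] [<- h]. move=> /IH[y' [-> h2]].
  by exists y'; split=> //; exists z.
- case=> y' [-> [z [h1 h2]]]; exists (a :: z); split; first by split.
  by apply/IH; exists y'.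
Qed.

(** Both sides of a base move are free of loops and join the same end points, hence impose the same
    condition on the labels there. *)
Lemma rch_base n u v : base n u v -> forall x, size x = n ->
  forall y, rch u x y <-> rch v x y.
Proof.
(* Strands on the left are peeled off one at a time, which leaves only position 0 to compute. *)
have lift (u' v' : rword) a (x : seq X) :
    (forall y, rch u' x y <-> rch v' x y) ->
    forall y, rch (sh1 u') (a :: x) y <-> rch (sh1 v') (a :: x) y.
  by move=> h y; rewrite !rch_sh1; split=> -[y' [-> /h]] ?; exists y'.
case.
- move=> k hk x hx; elim: k n hk x hx => [|k IH] [|n] // hk [|a x] // [hx].
    case: x hx => [|b x] hx y; first by rewrite /= in hx; lia.
    split.
    + by case=> ? [[? [? [? [[<- <- <-] ->]]]] [? [[? [? [? [[<- <- <-] ->]]]]] <-]].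
    + move=> <-; exists [:: b, a & x]; split; first by exists a, b, x.
      by exists [:: a, b & x]; split=> //; exists b, a, x.
  by apply: (lift [:: (k, GS); (k, GS)] [::]); apply: IH hx.
- move=> k hk x hx; elim: k n hk x hx => [|k IH] [|n] // hk [|a x] // [hx].
    case: x hx => [|b [|c x]] hx y; [by rewrite /= in hx; lia..|].
    split.
    + case=> ? [[? [? [? [[<- <- <-] ->]]]] [[|? ?]]] [//= [<-]].
      case=> ? [? [? [[<- <- <-] ->]]] [? [[? [? [? [[<- <- <-] ->]]]]] <-].
      exists [:: a, c, b & x]; split; first by split=> //; exists b, c, x.
      exists [:: c, a, b & x]; split; first by exists a, c, (b :: x).
      by exists [:: c, b, a & x]; split=> //; split=> //; exists a, b, x.
    + case=> [[|? ?]] [//= [<-]] [? [? [? [[<- <- <-] ->]]]].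
      case=> ? [[? [? [? [[<- <- <-] ->]]]]] [[|? ?]] [//= [<-]].
      case=> ? [? [? [[<- <- <-] ->]]] <-.
      exists [:: b, a, c & x]; split; first by exists a, b, (c :: x).
      exists [:: b, c, a & x]; split; first by split=> //; exists a, c, x.
      by exists [:: c, b, a & x]; split=> //; exists b, c, (a :: x).
  apply: (lift [:: (k, GS); (k.+1, GS); (k, GS)] [:: (k.+1, GS); (k, GS); (k.+1, GS)]).
  exact: IH hx.
- move=> k hk x hx; elim: k n hk x hx => [|k IH] [|n] // hk [|a x] // [hx].
    move=> y; split.
    + case=> [[|? ?]] [//= [<-]] [b ->] [z [[c [<- e <-]]] <-].
      by rewrite e duK.
    + move=> <-; exists [:: a, du a, a & x]; split=> /=.
        by split=> //; exists (du a); rewrite duK.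
      by exists (a :: x); split=> //; exists a.
  by apply: (lift [:: (k.+1, GCup); (k, GCap)] [::]); apply: IH hx.
- move=> k hk x hx; elim: k n hk x hx => [|k IH] [|n] // hk [|a x] // [hx].
    move=> y; split.
    + case=> ? [[b ->] [[|? z] [//= [<-]]]] [c [<- -> <-]] <-.
      by rewrite duK.
    + move=> <-; exists [:: a, du a, a & x]; split; first by exists a.
      by exists (a :: x); split=> //=; split=> //; exists (du a); rewrite duK.
  by apply: (lift [:: (k, GCup); (k.+1, GCap)] [::]); apply: IH hx.
- move=> k hk x hx; elim: k n hk x hx => [|k IH] [|n] // hk [|a x] // [hx].
    move=> y; split.
    + case=> ? [[b ->] [[|? z] [//= [<-]]]] [? [? [? [[<- <- <-] ->]]]] <-.
      exists [:: a, b, du b & x]; split; first by split=> //; exists b.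
      by exists [:: b, a, du b & x]; split=> //; exists a, b, (du b :: x).
    + case=> [[|? ?]] [//= [<-]] [b ->] [z [[? [? [? [[<- <- <-] ->]]]]] <-].
      exists [:: b, du b, a & x]; split; first by exists b.
      by exists [:: b, a, du b & x]; split=> //; split=> //; exists (du b), a, x.
  by apply: (lift [:: (k, GCup); (k.+1, GS)] [:: (k.+1, GCup); (k, GS)]); apply: IH hx.
- move=> k hk x hx; elim: k n hk x hx => [|k IH] n hk x hx; last first.
    case: n x hx hk => [|n] [|a x] // [hx] hk.
    by apply: (lift [:: (k, GCup); (k, GS)] [:: (k, GCup)]); apply: IH hx.
  move=> y; split.
  + case=> ? [[b ->]] [? [[? [? [? [[<- <- <-] ->]]]]] <-].
    exists [:: du b, b & x]; split=> //.
    by exists (du b); rewrite duK.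
  + case=> ? [[b ->]] <-; exists [:: du b, b & x]; split.
      by exists (du b); rewrite duK.
    by exists [:: b, du b & x]; split=> //; exists (du b), b, x.
- move=> k h j g hk x hx; elim: k n hk x hx => [|k IH] n hk x hx; last first.
    case: n x hx hk => [|n] [|a x] // [hx] hk.
    apply: (lift [:: (k, h); (k + tgt h + j, g)] [:: (k + src h + j, g); (k, h)]).
    by apply: IH hx; lia.
  move=> y; case: h hk; rewrite /= ?add0n.
  + move=> _; split.
    * case=> ? [[a [b [q [-> ->]]]]] [[|? [|? z]] [//= [<-] //]] [<- h] <-.
      exists [:: a, b & z]; split=> //.
      by exists [:: b, a & z]; split=> //; exists a, b, z.
    * case=> z [h [? [[a [b [q [e ->]]]] <-]]]; move: h; rewrite e {e}.
      case: x hx => [|a' [|b' x]] hx //=; first by case.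
      case=> -> [-> h].
      exists [:: b, a & x]; split; first by exists a, b, x.
      by exists [:: b, a & q].
  + move=> _; split.
    * case=> q [[a ->]] [z [h <-]].
      exists [:: a, du a & z]; split=> //.
      by exists z; split=> //; exists a.
    * case=> z [h [? [[a e] <-]]]; move: h; rewrite e {e}.
      case: x hx => [|a' [|b' x]] hx //=; first by case.
      case=> -> [-> h].
      exists x; split; first by exists a.
      by eexists; split; first exact: h.
  + move=> _; split.
    * case=> ? [[a ->]] [[|? [|? z]] [//= [<-] //]] [<- h] <-.
      by exists z; split=> //; exists [:: a, du a & z]; split=> //; exists a.
    * case=> z [h [? [[a ->] <-]]].
      exists [:: a, du a & x]; split; first by exists a.
      by exists [:: a, du a & z].
Qed.

Lemma rch_size u x y : rch u x y -> ok (size x) u /\ size y = out (size x) u.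
Proof.
elim: u x => [|[k g] u IH] x /=; first by move=> ->.
by case=> z [/lrel_size[-> <-] /IH[-> ->]].
Qed.

Lemma rch_mv L n u v x y : inhabited X -> mv L n u v -> size x = n -> rch v x y -> rch u x y.
Proof.
move=> [x0] h; elim: h x y => {n u v} //.
- by move=> n u v w _ IH1 _ IH2 x y hx /(IH2 _ _ hx)/(IH1 _ _ hx).
- move=> n p u v q h x y hx; rewrite !rch_cat => -[z [hz]]; rewrite rch_cat.
  case=> t [h1 h2]; exists z; split=> //; rewrite rch_cat; exists t; split=> //.
  by apply/(rch_base h) => //; case: (rch_size hz) => _ ->; rewrite hx.
- move=> n p u v q h x y hx; rewrite !rch_cat => -[z [hz]]; rewrite rch_cat.
  case=> t [h1 h2]; exists z; split=> //; rewrite rch_cat; exists t; split=> //.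
  by apply/(rch_base h) => //; case: (rch_size hz) => _ ->; rewrite hx.
- move=> n p k q _ hk x y hx; rewrite !rch_cat => -[z [hz h]]; exists z; split=> //.
  rewrite (rch_cat [:: _; _]); exists z; split=> //=.
  have hs : k <= size z by case: (rch_size hz) => _ ->; rewrite hx.
  (* The deleted loop is restored with the arbitrary label [x0]; hence the assumption that labels
     exist. *)
  exists (take k z ++ [:: x0, du x0 & drop k z]).
  have hp : size (take k z) = k by rewrite size_takel.
  have hcat g x1 x2 := (lrel_cat (take k z) g x1 x2).2; rewrite hp in hcat.
  split; first by rewrite -{1}(cat_take_drop k z); apply: hcat; exists x0.
  exists z; split=> //; rewrite -{3}(cat_take_drop k z); apply: hcat; by exists x0.
Qed.
End Chains.

(** * Derived moves *)

Lemma mv_sym n u v : mv false n u v -> mv false n v u.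
Proof.
elim=> {n u v} //.
- by move=> *; exact: mv_refl.
- by move=> n u v w _ h1 _ h2; exact: mv_trans h2 h1.
- by move=> *; exact: mv_base_sym.
- by move=> *; exact: mv_base.
Qed.

Lemma mvW L n u v : mv false n u v -> mv L n u v.
Proof.
elim=> {n u v} //.
- by move=> *; exact: mv_refl.
- by move=> n u v w _ h1 _ h2; exact: mv_trans h1 h2.
- by move=> *; exact: mv_base.
- by move=> *; exact: mv_base_sym.
Qed.

Lemma base_interchange n k h k1 k2 g : k + tgt h <= k1 -> k2 + tgt h = k1 + src h ->
  k2 + src g <= n -> base n [:: (k, h); (k1, g)] [:: (k2, g); (k, h)].
Proof.
move=> h1 h2 h3.
have -> : k1 = k + tgt h + (k1 - (k + tgt h)) by lia.
have -> : k2 = k + src h + (k1 - (k + tgt h)) by lia.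
by apply: base_int; lia.
Qed.

Ltac side := rewrite ?out_cat /= /step /=; lia.

(** A zigzag is inserted below. The crossing moves down past its cap, (R3) applies at its cup, and
    the cup is straightened against the original cap. *)
Lemma mv_cap_slide n k : k.+3 <= n ->
  mv false n [:: (k, GS); (k.+1, GCap)] [:: (k.+1, GS); (k, GCap)].
Proof.
move=> hn.
apply: mv_trans (@mv_base_sym _ n [::] _ _ [:: (k, GS); (k.+1, GCap)]
  (@base_zz1 n k _)) _; first by side.
apply: mv_trans (@mv_base _ n [:: (k.+1, GCup)] _ _ [:: (k.+1, GCap)]
  (@base_interchange _ k GCap k k.+2 GS _ _ _)) _; [side..|].
apply: mv_trans (@mv_base _ n [::] _ _ [:: (k, GCap); (k.+1, GCap)]
  (@base_slide _ k.+1 _)) _; first by side.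
apply: mv_trans (@mv_base _ n [:: (k.+2, GCup); (k.+1, GS)] _ _ [::]
  (@base_interchange _ k GCap k.+1 k.+3 GCap _ _ _)) _; [side..|].
apply: mv_trans (@mv_base _ n [:: (k.+2, GCup)] _ _ [:: (k, GCap)]
  (@base_interchange _ k.+1 GS k.+3 k.+3 GCap _ _ _)) _; [side..|].
by apply: (@mv_base _ n [::] _ _ [:: (k.+1, GS); (k, GCap)] (@base_zz2 _ k.+2 _)); side.
Qed.

(** The same bending reduces this to the twist of a cup. The scalar lost here is recovered later
    from the representation. *)
Lemma mv_cap_twist n k : k.+2 <= n -> mv false n [:: (k, GS); (k, GCap)] [:: (k, GCap)].
Proof.
move=> hn.
apply: mv_trans (@mv_base_sym _ n [::] _ _ [:: (k, GS); (k, GCap)]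
  (@base_zz1 n k _)) _; first by side.
apply: mv_trans (@mv_base _ n [:: (k.+1, GCup)] _ _ [:: (k, GCap)]
  (@base_interchange _ k GCap k k.+2 GS _ _ _)) _; [side..|].
apply: mv_trans (@mv_base _ n [:: (k.+1, GCup); (k.+2, GS)] _ _ [::]
  (@base_interchange _ k GCap k k.+2 GCap _ _ _)) _; [side..|].
apply: mv_trans (@mv_base _ n [::] _ _ [:: (k.+2, GCap); (k, GCap)]
  (@base_slide _ k.+1 _)) _; first by side.
apply: mv_trans (@mv_ctx _ n [:: (k.+2, GCup)] _ _ [:: (k, GCap)]
  (@mv_cap_slide _ k.+1 _)) _; first by side.
apply: mv_trans (@mv_base _ n [::] _ _ [:: (k.+1, GCap); (k, GCap)]
  (@base_twist _ k.+2 _)) _; first by side.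
by apply: (@mv_base _ n [::] _ _ [:: (k, GCap)] (@base_zz1 _ k.+1 _)); side.
Qed.

(** * Standard cup diagrams *)

(* [arc t] inserts an arc joining the new points 0 and t+1. *)
Definition arc (t : nat) : rword := (0, GCup) :: [seq (i, GS) | i <- iota 1 t].

Arguments arc : simpl never.

Lemma arcS t : arc t.+1 = arc t ++ [:: (t.+1, GS)].
Proof. by rewrite /arc -[in LHS](addn1 t) iotaD map_cat. Qed.

Lemma out_arc m t : out m (arc t) = m.+2.
Proof.
elim: t => [|t IH]; first by rewrite /arc /= /step /=; lia.
by rewrite arcS out_cat IH /= /step /=; lia.
Qed.

Lemma ok_arc m t : t <= m -> ok m (arc t).
Proof.
elim: t => [|t IH] h //; rewrite arcS ok_cat IH ?out_arc /=; lia.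
Qed.

(** * Moving crossings through arcs *)

Lemma mv_ss n k : k.+2 <= n -> mv false n [:: (k, GS); (k, GS)] [::].
Proof. by move=> h; apply: mvb; apply: base_ss. Qed.

Lemma mv_comm n i j : i.+2 <= j -> j.+2 <= n ->
  mv false n [:: (i, GS); (j, GS)] [:: (j, GS); (i, GS)].
Proof. by move=> h1 h2; apply/mvb/base_interchange => /=; lia. Qed.

(** The crossing lies to the right of both ends of the arc; below the arc these two points are
    missing, hence [i.-2]. *)
Lemma arc_far m t i : t.+2 <= i -> i <= m ->
  mv false m (arc t ++ [:: (i, GS)]) ((i.-2, GS) :: arc t).
Proof.
move=> h1 h2; elim: t h1 => [|t IH] h1.
  by apply/mvb/base_interchange => /=; lia.
rewrite arcS -catA.
apply: mv_trans (mv_pre _) _; first by apply: mv_comm; rewrite ?out_arc; lia.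
by rewrite -[[:: _; _]]cat1s catA -cat_cons; apply: mv_post; apply: IH; lia.
Qed.

(** Both crossing strands run between the ends of the arc. The essential case [t = i.+2] is a braid
    move; below the arc only its left end is missing on the left, so the index drops by one. *)
Lemma arc_near m t i : i.+2 <= t -> t <= m ->
  mv false m (arc t ++ [:: (i.+1, GS)]) ((i, GS) :: arc t).
Proof.
move=> h1 h2; elim: t h1 h2 => [|t IH] // h1 h2.
case: (ltngtP i.+2 t.+1) h1 => // h1 _.
- rewrite arcS -catA.
  apply: mv_trans (mv_pre (mv_sym (@mv_comm _ i.+1 t.+1 _ _))) _; rewrite ?out_arc; try lia.
  by rewrite -[[:: _; _]]cat1s catA -cat_cons; apply: mv_post; apply: IH; lia.
- case: h1 => {IH} h1; rewrite -h1 in h2 *; rewrite !arcS.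
  have -> : ((arc i ++ [:: (i.+1, GS)]) ++ [:: (i.+2, GS)]) ++ [:: (i.+1, GS)] =
    arc i ++ [:: (i.+1, GS); (i.+2, GS); (i.+1, GS)] by rewrite -!catA.
  apply: mv_trans (@mv_pre _ m (arc i) _ _ (mvb _ (@base_braid _ i.+1 _))) _;
    first by rewrite out_arc; lia.
  rewrite -cat1s catA.
  apply: mv_trans (mv_post _ (@arc_far _ i i.+2 _ _)) _; try lia.
  by rewrite /= -catA; exact: mv_refl.
Qed.

Lemma arc_swap2 m : mv false m (arc 0 ++ arc 1 ++ [:: (0, GS)]) (arc 0 ++ arc 2).
Proof.
apply: (@mv_trans _ _ _ [:: (0, GCup); (1, GCup)]).
  apply: mv_trans (@mv_base _ m [:: (0, GCup)] _ _ [:: (0, GS)] (@base_slide _ 0 _)) _;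
    first by side.
  by apply: (@mv_base _ m [:: (0, GCup); (1, GCup)] _ _ [::] (@base_ss _ 0 _)); side.
apply: mv_trans (@mv_base_sym _ m [:: (0, GCup); (1, GCup)] _ _ [::]
  (@base_ss _ 2 _)) _; first by side.
apply: mv_trans (@mv_base _ m [:: (0, GCup)] _ _ [:: (2, GS)] (@base_slide _ 1 _)) _;
    first by side.
by apply: (@mv_base _ m [::] _ _ [:: (1, GS); (2, GS)]
  (@base_interchange _ 0 GCup 2 0 GCup _ _ _)); side.
Qed.

Lemma arc_swap1 m t' : t' <= m ->
  mv false m (arc t' ++ arc 1 ++ [:: (0, GS)]) (arc 0 ++ arc t'.+2).
Proof.
elim: t' => [|t' IH] h; first exact: arc_swap2.
rewrite [arc t'.+1]arcS -catA.
apply: mv_trans (mv_pre _) _.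
  rewrite out_arc catA; apply: mv_post; apply: mv_sym.
  by apply: (@arc_far _ 1 t'.+3); lia.
rewrite -catA.
apply: mv_trans (_ : mv _ _ _ (arc t' ++ arc 1 ++ [:: (0, GS); (t'.+3, GS)])) _.
  apply: mv_pre; apply: mv_pre; rewrite !out_arc; apply: mv_sym.
  by apply: mv_comm; lia.
rewrite [arc t'.+3]arcS [X in mv _ _ _ X]catA.
have -> : arc t' ++ arc 1 ++ [:: (0, GS); (t'.+3, GS)] =
   (arc t' ++ arc 1 ++ [:: (0, GS)]) ++ [:: (t'.+3, GS)] by rewrite -!catA.
by apply: mv_post; apply: IH; lia.
Qed.

(** The crossing exchanges the left ends of two arcs: both sides join 0 to [t'.+3] and 1 to [t.+2].
    Induction on [t] starts at [arc_swap1], itself an induction on [t'] from [arc_swap2]. *)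
Lemma arc_swap m t t' : t <= t' -> t' <= m ->
  mv false m (arc t' ++ arc t.+1 ++ [:: (0, GS)]) (arc t ++ arc t'.+2).
Proof.
move=> h h'; elim: t h => [|t IH] h; first exact: arc_swap1.
rewrite [arc t.+2]arcS -catA.
apply: mv_trans (_ : mv _ _ _ (arc t' ++ arc t.+1 ++ [:: (0, GS); (t.+2, GS)])) _.
  apply: mv_pre; apply: mv_pre; rewrite !out_arc; apply: mv_sym.
  by apply: mv_comm; lia.
have -> : arc t' ++ arc t.+1 ++ [:: (0, GS); (t.+2, GS)] =
   (arc t' ++ arc t.+1 ++ [:: (0, GS)]) ++ [:: (t.+2, GS)] by rewrite -!catA.
apply: mv_trans (mv_post _ (IH _)) _; first by lia.
rewrite -catA [arc t.+1]arcS -catA; apply: mv_pre; rewrite out_arc.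
by apply: arc_near; lia.
Qed.

(** Codes of the perfect matchings of [n] points: the head [t] joins the leftmost point to the point
    [t.+1], the tail matches the remaining points. *)
Fixpoint codes (n : nat) : seq (seq nat) :=
  match n with
  | 0 => [:: [::]]
  | 1 => [::]
  | m.+2 => [seq t :: ts | t <- iota 0 m.+1, ts <- codes m]
  end.

Lemma codesP m ts : reflect
  (exists t ts', [/\ t <= m, ts' \in codes m & ts = t :: ts']) (ts \in codes m.+2).
Proof.
apply: (iffP allpairsP) => [[[t ts'] [/= h1 h2 ->]]|[t [ts' [h1 h2 ->]]]].
  by exists t, ts'; split=> //; have: t \in iota 0 m.+1 := h1; rewrite mem_iota; lia.
exists (t, ts'); split=> //; change (t \in iota 0 m.+1); rewrite mem_iota; lia.
Qed.

Lemma codes_cons m t ts : t <= m -> ts \in codes m -> t :: ts \in codes m.+2.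
Proof. by move=> h1 h2; apply/codesP; exists t, ts. Qed.

Fixpoint cups (ts : seq nat) : rword :=
  if ts is t :: ts' then cups ts' ++ arc t else [::].

Lemma cups_cons t ts : cups (t :: ts) = cups ts ++ arc t.
Proof. by []. Qed.

Lemma cups_ok n ts : ts \in codes n -> ok 0 (cups ts) /\ out 0 (cups ts) = n.
Proof.
elim/ltn_ind: n ts => -[|[|m]] IH ts //; first by rewrite inE => /eqP ->.
case/codesP=> t [ts' [h1 h2 ->]] /=; have [|h3 h4] := IH m _ ts' h2; first by lia.
by rewrite ok_cat out_cat h3 h4 ok_arc // out_arc.
Qed.

(** * Closure of the standard cup diagrams under the generators *)

Definition reduces L n u := exists2 ts, ts \in codes n & mv L 0 u (cups ts).

Lemma reduces_trans L n u v : mv L 0 u v -> reduces L n v -> reduces L n u.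
Proof. by move=> h [ts h1 h2]; exists ts => //; apply: mv_trans h h2. Qed.

Lemma reduces_pre L n ts u v : ts \in codes n -> mv L n u v ->
  forall m, reduces L m (cups ts ++ v) -> reduces L m (cups ts ++ u).
Proof.
move=> h1 h2 m; apply: reduces_trans; apply: mv_pre.
by have [_ ->] := cups_ok h1.
Qed.

(** A crossing at 0 twists the arc [arc t] or exchanges the left ends of two arcs. At the right end
    it shortens or lengthens the arc. Elsewhere it moves below the arc, where induction applies. *)
Lemma cross_closed n ts i : ts \in codes n -> i.+2 <= n ->
  reduces false n (cups ts ++ [:: (i, GS)]).
Proof.
elim/ltn_ind: n ts i => -[|[|m]] IH ts i // /codesP[t [ts' [h1 h2 ->]]] hi.
have IHm j : j.+2 <= m -> forall t, t <= m ->
    reduces false m.+2 (cups ts' ++ (j, GS) :: arc t).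
  move=> hj s hs; have [|us hus hmv] := IH m _ ts' j h2 hj; first by lia.
  exists (s :: us); first exact: codes_cons.
  by rewrite -cat1s catA; apply: mv_post.
rewrite cups_cons -catA; case: i hi => [|i] hi.
  case: t h1 => [|t] ht.
    apply: (reduces_pre h2) (mvb _ (base_twist (leq0n _))) _ _.
    by exists (0 :: ts'); [exact: codes_cons | exact: mv_refl].
  case: m {hi} IH IHm h2 ht => [|[|m]] // IH IHm /codesP[t' [ts'' [h1' h2' ->]]] ht.
  case: (leqP t t') => htt.
    exists [:: t'.+2, t & ts'']; first by rewrite !codes_cons //; lia.
    by rewrite !cups_cons -!catA; apply: mv_pre; have [_ ->] := cups_ok h2'; apply: arc_swap.
  case: t ht htt => // t ht htt.
  exists [:: t'.+1, t & ts'']; first by rewrite !codes_cons //; lia.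
  rewrite !cups_cons -!catA; apply: mv_pre; have [_ ->] := cups_ok h2'.
  (* With the arcs in the opposite order [arc_swap] is read backwards, and the two crossings at 0
     cancel. *)
  apply: mv_trans (_ : mv _ _ _ ((arc t ++ arc t'.+1 ++ [:: (0, GS)]) ++ [:: (0, GS)])) _.
    by rewrite [X in mv _ _ X _]catA; apply: mv_post; apply: mv_sym; apply: arc_swap; lia.
  rewrite -!catA; apply: mv_pre; rewrite -{2}[arc t'.+1]cats0; apply: mv_pre.
  by rewrite !out_arc; apply: mv_ss; lia.
case: (ltngtP i t) => hit.
- case: (ltngtP i.+1 t) hit => // hit _.
    apply: (reduces_pre h2) (arc_near _ _) _ _ => //; apply: IHm => //; lia.
  rewrite -hit in h1 *; rewrite arcS -catA.
  exists (i :: ts'); first by rewrite codes_cons //; lia.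
  apply: mv_pre; have [_ ->] := cups_ok h2; rewrite -{2}[arc i]cats0; apply: mv_pre.
  by rewrite !out_arc; apply: mv_ss; lia.
- apply: (reduces_pre h2) (arc_far _ _) _ _; [lia..|].
  by case: i hi hit => // i hi hit; apply: IHm => //; lia.
- rewrite hit in hi *; exists (t.+1 :: ts'); first by rewrite codes_cons //; lia.
  by rewrite /= arcS; exact: mv_refl.
Qed.

Lemma reducesW L n u : reduces false n u -> reduces L n u.
Proof. by case=> ts h1 h2; exists ts => //; apply: mvW. Qed.

Lemma reduces_cat L n m u v : reduces L n u ->
  (forall ts, ts \in codes n -> reduces L m (cups ts ++ v)) -> reduces L m (u ++ v).
Proof. by case=> ts h1 h2 /(_ _ h1); apply: reduces_trans; apply: mv_post. Qed.

(** By the slide relation and [s o s = 1], a cup at [k.+1] is a cup at [k] followed by two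
    crossings. *)
Lemma cup_closed n ts k : ts \in codes n -> k <= n ->
  reduces false n.+2 (cups ts ++ [:: (k, GCup)]).
Proof.
move=> h; elim: k => [|k IH] hk.
  by exists (0 :: ts); [exact: codes_cons | exact: mv_refl].
apply: (reduces_pre h) (_ : mv _ _ _ [:: (k, GCup); (k.+1, GS); (k, GS)]) _ _.
  apply: mv_trans (@mv_base_sym _ n [:: (k.+1, GCup)] _ _ [::] (@base_ss _ k _)) _;
    first by side.
  by apply: (@mv_base_sym _ n [::] _ _ [:: (k, GS)] (@base_slide _ k _)); side.
rewrite -cat1s catA; apply: reduces_cat (IH _) _ => [|us hus]; first by lia.
rewrite -cat1s catA; apply: reduces_cat (cross_closed hus _) _ => [|vs hvs]; first by lia.
by apply: cross_closed => //; lia.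
Qed.

(** The cap joins the left end of the arc to the former strand 0, which is thus carried along the
    arc to position [t]. *)
Lemma arc_cap m t : t.+1 <= m ->
  mv false m (arc t.+1 ++ [:: (0, GCap)]) [seq (i, GS) | i <- iota 0 t].
Proof.
elim: t => [|t IH] h.
  apply: mv_trans (@mv_base _ m [::] _ _ [:: (0, GCap)] (@base_slide _ 0 _)) _;
    first by side.
  apply: mv_trans (@mv_ctx _ m [:: (1, GCup)] _ _ [::] (@mv_cap_twist _ 0 _)) _;
    first by side.
  by apply/mvb/base_zz1; lia.
rewrite arcS -catA.
apply: mv_trans (_ : mv _ _ _ (arc t.+1 ++ [:: (0, GCap); (t, GS)])) _.
  apply: mv_pre; rewrite out_arc; apply/mvbs/base_interchange => /=; lia.
have -> : iota 0 t.+1 = iota 0 t ++ [:: t] by rewrite -[in LHS](addn1 t) iotaD.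
rewrite -[[:: _; _]]cat1s catA map_cat; apply: mv_post; apply: IH; lia.
Qed.

Lemma crosses_closed n ts s : ts \in codes n -> all (fun i => i.+2 <= n) s ->
  reduces false n (cups ts ++ [seq (i, GS) | i <- s]).
Proof.
elim: s ts => [|i s IH] ts h /=.
  by move=> _; exists ts => //; rewrite cats0; exact: mv_refl.
case/andP=> hi hs; rewrite -cat1s catA.
by apply: reduces_cat (cross_closed h hi) _ => us hus; apply: IH.
Qed.

(** Two crossings bring the cap one position to the left. At position 0 it closes [arc 0] to a loop,
    the only source of loop deletions, or pulls a longer arc straight. *)
Lemma cap_closed n ts k : ts \in codes n -> k.+2 <= n ->
  reduces true n.-2 (cups ts ++ [:: (k, GCap)]).
Proof.
elim: k ts => [|k IH] ts h hk.
  case: n h hk => [|[|m]] // /codesP[t [ts' [h1 h2 ->]]] _ /=; rewrite -catA.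
  case: t h1 => [|t] h1.
    exists ts' => //; rewrite -{2}[cups ts']cats0; apply: mv_pre.
    by apply: (@mv_loop true _ [::] 0 [::]).
  apply: (reduces_pre h2) (mvW _ (arc_cap h1)) _ _; apply: reducesW.
  by apply: crosses_closed => //; apply/allP => i; rewrite mem_iota; lia.
apply: (reduces_pre h) (_ : mv _ _ _ [:: (k, GS); (k.+1, GS); (k, GCap)]) _ _.
  apply: mv_trans (@mv_base_sym _ n [::] _ _ [:: (k.+1, GCap)] (@base_ss _ k _)) _;
    first by side.
  by apply: mvW; apply: (@mv_pre _ n [:: (k, GS)]); apply: mv_cap_slide; side.
rewrite -cat1s catA.
apply: reduces_cat (reducesW _ (cross_closed h _)) _ => [|us hus]; first by lia.
rewrite -cat1s catA.
apply: reduces_cat (reducesW _ (cross_closed hus _)) _ => [|vs hvs]; first by lia.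
by apply: IH => //; lia.
Qed.

Lemma word_reduces u : ok 0 u -> reduces true (out 0 u) u.
Proof.
elim/last_ind: u => [|u [k g] IH]; first by move=> _; exists [::]; [|exact: mv_refl].
rewrite -cats1 ok_cat out_cat => /andP[/IH h]; rewrite /= andbT => hk.
apply: reduces_cat h _ => ts hts; rewrite /step; case: g hk => /= hk.
- by rewrite subnK; last lia; apply/reducesW/cross_closed => //; lia.
- by rewrite subn2 addn0; apply: cap_closed => //; lia.
- by rewrite subn0 addn2; apply/reducesW/cup_closed => //; lia.
Qed.

(** * Bending *)

(** The last [a] of the [a + b] top points are bent down: each recursive step adds a bottom strand
    on the right and caps it with the last top point. *)
Fixpoint std (a b : nat) (ts : seq nat) : rword :=
  if a is a'.+1 then std a' b.+1 ts ++ [:: (b, GCap)] else cups ts.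

Lemma mv_cap_right a u : ok a u ->
  mv false a.+2 ((a, GCap) :: u) (u ++ [:: (out a u, GCap)]).
Proof.
elim: u a => [|[k g] u IH] a; first by move=> _; exact: mv_refl.
case/andP=> h1 h2.
apply: mv_trans (@mv_base_sym _ _ [::] _ _ u
  (@base_interchange _ k g (step a g) a GCap _ _ _)) _; rewrite /step /=; try lia.
apply: (@mv_pre _ _ [:: (k, g)]).
have -> : out a.+2 [:: (k, g)] = (step a g).+2 by rewrite /= /step; lia.
exact: IH.
Qed.

(** A zigzag is inserted in the last bottom strand and its cap moved above [u]; its cup together
    with [u] has one bottom strand less. *)
Lemma word_std a b u : ok a u -> out a u = b ->
  exists2 ts, ts \in codes (a + b) & mv true a u (std a b ts).
Proof.
elim: a b u => [|a IH] b u hu hb; first by rewrite -hb; exact: word_reduces.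
have st : step a GCup = a.+2 by rewrite /step /=; lia.
have hu2 : ok a ((a, GCup) :: u).
  change ((a + 0 <= a) && ok (step a GCup) u).
  by rewrite addn0 leqnn st; exact: ok_S.
have ho : out a ((a, GCup) :: u) = b.+1.
  by change (out (step a GCup) u = b.+1); rewrite st out_S // hb.
have [ts h1 h2] := IH _ _ hu2 ho; exists ts; first by rewrite addSnnS.
apply: mv_trans (_ : mv _ _ _ ((a, GCup) :: u ++ [:: (b, GCap)])) _; last first.
  by rewrite -cat_cons; apply: mv_post; apply: mv_S.
apply: mv_trans (@mv_base_sym _ _ [::] _ _ u (@base_zz2 _ a _)) _ => //=.
apply: (@mv_pre _ _ [:: (a, GCup)]).
have -> : out a.+1 [:: (a, GCup)] = a.+3 by rewrite /= /step /=; lia.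
by rewrite -hb; apply/mvW/mv_cap_right.
Qed.

(** * Soundness of the moves modulo the ideal *)

Section Soundness.
Variable F : fieldType.

Definition weq n m (c : F) (u v : word) := ideal n m [:: (1, u); (- c, v)]%R.

Lemma comb_coef_cons (c : F) u x w :
  coef ((c, u) :: x) w = ((if u == w then c else 0) + coef x w)%R.
Proof. by rewrite /coef big_cons /=; case: eqP => _; rewrite ?add0r. Qed.

Lemma comb_coef_nil w : coef ([::] : comb F) w = 0%R.
Proof. by rewrite /coef big_nil. Qed.

Local Ltac coefs := move=> ?; rewrite /= ?comb_coef_cons ?comb_coef_nil;
  do ?case: eqP => _ //=; try ring.

Lemma weq_refl n m u : weq n m 1 u u.
Proof. by apply: id_ext (id_nil F n m) _; coefs. Qed.

Lemma weq_trans n m c d u v w : weq n m c u v -> weq n m d v w -> weq n m (c * d) u w.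
Proof.
move=> h1 h2; apply: id_ext (id_add h1 (id_scale c h2)) _; coefs.
Qed.

Lemma weq_sym n m c u v : (c != 0)%R -> weq n m c u v -> weq n m (c^-1) v u.
Proof.
move=> hc h; apply: id_ext (id_scale (- c^-1)%R h) _ => w.
have E : (- c^-1 * - c = 1)%R by rewrite mulrNN mulVf.
by rewrite /= E !comb_coef_cons comb_coef_nil; do 2!case: eqP => _; ring.
Qed.

Lemma weq_ctx n m n' m' c p q u v : wf n' n p -> wf m m' q -> weq n m c u v ->
  weq n' m' c (p ++ u ++ q) (p ++ v ++ q).
Proof. by move=> hp hq h; have := id_pre hp (id_post hq h). Qed.

Lemma weq_place k r n m c u v : weq n m c u v ->
  weq (k + n + r) (k + m + r) c (shr r (shl k u)) (shr r (shl k v)).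
Proof. by move=> h; have := id_shr r (id_shl k h). Qed.

Lemma weq_cast n m n' m' c u v u' v' :
  weq n m c u v -> n = n' -> m = m' -> u = u' -> v = v' ->
  weq n' m' c u' v'.
Proof. by move=> h <- <- <- <-. Qed.

Local Ltac lay := rewrite /= /step /=;
  repeat match goal with
  | |- (_ :: _) = (_ :: _) => f_equal
  | |- (_, _) = (_, _) => f_equal
  end; try lia.

Lemma base_weq n u v : base n u v ->
  exists2 c : F, (c != 0)%R & weq n (out n u) c (el n u) (el n v).
Proof.
have neg1 : (-1 : F)%R != 0%R by rewrite oppr_eq0 oner_neq0.
case.
- move=> k hk; exists 1%R; first exact: oner_neq0.
  have h0 : weq 2 2 1 [:: (0, GS, 0); (0, GS, 0)] [::] := id_rel (rel_ss F).
  by apply: (weq_cast (weq_place k (n - k.+2) h0)); lay.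
- move=> k hk; exists 1%R; first exact: oner_neq0.
  have h0 : weq 3 3 1 [:: (0,GS,1); (1,GS,0); (0,GS,1)] [:: (1,GS,0); (0,GS,1); (1,GS,0)]
    := id_rel (rel_braid F).
  by apply: (weq_cast (weq_place k (n - k.+3) h0)); lay.
- move=> k hk; exists (-1)%R; first exact: neg1.
  have h0 : weq 1 1 (-1)%R [:: (1,GCup,0); (0,GCap,1)] [::].
    by rewrite /weq opprK; exact: id_rel (rel_zz1 F).
  by apply: (weq_cast (weq_place k (n - k.+1) h0)); lay.
- move=> k hk; exists 1%R; first exact: oner_neq0.
  have h0 : weq 1 1 1 [:: (0,GCup,1); (1,GCap,0)] [::] := id_rel (rel_zz2 F).
  by apply: (weq_cast (weq_place k (n - k.+1) h0)); lay.
- move=> k hk; exists 1%R; first exact: oner_neq0.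
  have h0 : weq 1 3 1 [:: (0,GCup,1); (1,GS,0)] [:: (1,GCup,0); (0,GS,1)]
    := id_rel (rel_slide F).
  by apply: (weq_cast (weq_place k (n - k.+1) h0)); lay.
- move=> k hk; exists (-1)%R; first exact: neg1.
  have h0 : weq 0 2 (-1)%R [:: (0,GCup,0); (0,GS,0)] [:: (0,GCup,0)].
    by rewrite /weq opprK; exact: id_rel (rel_twist F).
  by apply: (weq_cast (weq_place k (n - k) h0)); lay.
- move=> k h j g hk; exists ((-1) ^+ (gpar h && gpar g))%R; first by rewrite signr_eq0.
  have h0 : weq (k + src h + j + src g + (n - (k + src h + j + src g)))
     (k + tgt h + j + tgt g + (n - (k + src h + j + src g))) ((-1) ^+ (gpar h && gpar g))%R
     [:: (k, h, j + src g + (n - (k + src h + j + src g)));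
         (k + tgt h + j, g, n - (k + src h + j + src g))]
     [:: (k + src h + j, g, n - (k + src h + j + src g));
         (k, h, j + tgt g + (n - (k + src h + j + src g)))]
    := id_rel (rel_interchange F k j (n - (k + src h + j + src g)) h g).
  by apply: (weq_cast h0); lay.
Qed.

(** Vanishing of loops is a hypothesis because its own proof relies on the case [L = false]. *)
Lemma mv_weq_gen (L : bool) n u v : (L -> weq 0 0 0 [:: (0,GCup,0); (0,GCap,0)] [::]) ->
  mv L n u v -> ok n u ->
  exists2 c : F, ~~ L -> (c != 0)%R & weq n (out n u) c (el n u) (el n v).
Proof.
move=> hL; elim=> {n u v}.
- by move=> n u _; exists 1%R; [rewrite oner_neq0 | exact: weq_refl].
- move=> n u v w h1 IH1 h2 IH2 hu.
  have [c hc hw] := IH1 hu; have [hv ho] := mv_ok h1 hu.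
  have [d hd hw'] := IH2 hv; exists (c * d)%R; first by move=> h; rewrite mulf_neq0 ?hc ?hd.
  by apply: weq_trans hw _; rewrite -ho.
- move=> n p u v q hb; have [c hc hw] := base_weq hb; have [_ _ ho] := base_ok hb.
  rewrite !ok_cat => /and3P[okp oku okq]; exists c => //.
  by rewrite !el_cat !out_cat -ho; apply: weq_ctx hw; exact: el_wf.
- move=> n p u v q hb; have [c hc hw] := base_weq hb; have [_ _ ho] := base_ok hb.
  rewrite !ok_cat => /and3P[okp oku okq]; exists (c^-1)%R; first by rewrite invr_eq0.
  rewrite !el_cat !out_cat -ho in okq *.
  by apply: weq_ctx (weq_sym hc hw); exact: el_wf.
- move=> n p k q /[dup] hLt /hL hw hk okpq; exists 0%R; first by rewrite hLt.
  move: okpq; rewrite !ok_cat !out_cat !el_cat => /and3P[okp _ okq].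
  have E : out (out n p) [:: (k, GCup); (k, GCap)] = out n p by rewrite /= /step /=; lia.
  rewrite E in okq *.
  apply: (@weq_ctx (out n p) (out n p) _ _ _ _ _ _ [::]); [exact: el_wf|exact: el_wf|].
  by apply: (weq_cast (weq_place k (out n p - k) hw)); lay.
Qed.

Hypothesis two_neq0 : (2%:R != 0 :> F)%R.

(* The sign in [b o s = b] is read off from the representation. *)
Lemma weq_cap_twist : weq 2 0 1 [:: (0, GS, 0); (0, GCap, 0)] [:: (0, GCap, 0)].
Proof.
have [//|//|c _ h] := @mv_weq_gen false 2 _ _ _ (@mv_cap_twist 2 0 (leqnn _)).
suff e : c = 1%R by rewrite e in h.
(* One colour suffices: the crossing of an even with an odd label has sign 1, so both diagrams
   evaluate to 1 and [c = 1]. *)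
have /eqP := act_ideal h false (fun=> 1%R) (y := [:: (tt, false); (tt, true)]) erefl.
by rewrite eval2 /act /act_layer /= /sg /= expr0 !mul1r mulr1 subr_eq0 => /eqP.
Qed.

(** In the loop with one crossing inserted, absorbing the crossing into the cap gives the loop,
    absorbing it into the cup gives minus the loop; 2 is invertible. *)
Lemma weq_loop : weq 0 0 0 [:: (0, GCup, 0); (0, GCap, 0)] [::].
Proof.
have h1 := @weq_ctx 2 0 0 0 _ [:: (0, GCup, 0)] [::] _ _ isT isT weq_cap_twist.
have h2 : weq 0 2 (-1)%R [:: (0,GCup,0); (0,GS,0)] [:: (0,GCup,0)].
  by rewrite /weq opprK; exact: id_rel (rel_twist F).
have {}h2 := @weq_ctx 0 2 0 0 _ [::] [:: (0, GCap, 0)] _ _ isT isT h2.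
apply: id_ext (id_scale (- 2%:R^-1)%R (id_add h1 (id_scale (-1)%R h2))) _ => w.
rewrite /= !comb_coef_cons comb_coef_nil.
case: eqP => _; case: eqP => _; case: eqP => _; by field.
Qed.

Lemma mv_weq n u v : mv true n u v -> ok n u ->
  exists c : F, weq n (out n u) c (el n u) (el n v).
Proof. by move=> h1 h2; have [c _ hc] := mv_weq_gen (fun _ => weq_loop) h1 h2; exists c. Qed.

End Soundness.

(** * Existence of orientations *)

Lemma lrel_total (X : Type) (du : X -> X) (x0 : X) k g x : g != GCap ->
  k + src g <= size x -> exists z, lrel du k g x z.
Proof.
move=> hg; elim: k x => [|k IH] x.
  case: g hg => //= _; first by case: x => [|a [|b q]] // _; exists [:: b, a & q], a, b, q.
  by move=> _; exists [:: x0, du x0 & x], x0.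
by case: x => [|a x] //= /IH[z hz]; exists (a :: z).
Qed.

Lemma rch_total (X : Type) (du : X -> X) (x0 : X) u x :
  all (fun l => l.2 != GCap) u -> ok (size x) u -> exists y, rch du u x y.
Proof.
elim: u x => [|[k g] u IH] x /=; first by exists x.
case/andP=> hg hu /andP[hk ho]; have [z hz] := lrel_total du x0 hg hk.
have [_ hs] := lrel_size hz; rewrite -hs in ho.
by have [y hy] := IH _ hu ho; exists y, z.
Qed.

Lemma cups_nocap ts : all (fun l => l.2 != GCap) (cups ts).
Proof.
elim: ts => //= t ts; rewrite all_cat => -> /=.
by rewrite all_map; apply/allP.
Qed.

Lemma lrel_right (X : Type) (du : X -> X) k g x z s :
  lrel du k g x z -> lrel du k g (x ++ s) (z ++ s).
Proof.
elim: k x z => [|k IH] x z /=.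
  case: g => [[a [b [q [-> ->]]]]|[a ->]|[a ->]]; [|by exists a..].
  by exists a, b, (q ++ s).
by case: x => // a x; case: z => // b z [-> /IH].
Qed.

Lemma rch_right (X : Type) (du : X -> X) u x y s : rch du u x y -> rch du u (x ++ s) (y ++ s).
Proof.
elim: u x => [|[k g] u IH] x /=; first by move=> ->.
by case=> z [/lrel_right h1 /IH h2]; exists (z ++ s).
Qed.

Lemma std_out a b ts : ts \in codes (a + b) -> out a (std a b ts) = b /\ ok a (std a b ts).
Proof.
elim: a b => [|a IH] b h; first by have [] := cups_ok h.
rewrite addSnnS in h; have [h1 h2] := IH _ h.
rewrite /= out_cat ok_cat out_S // h1 ok_S //= /step /=; split; lia.
Qed.

(** Words without caps can be labelled from the bottom upwards; each bend then adds a bottom strand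
    whose label is opposite to that of the top point it is joined to. *)
Lemma std_oriented a b ts : ts \in codes (a + b) ->
  exists x y, size x = a /\ rch negb (std a b ts) x y.
Proof.
elim: a b => [|a IH] b h.
  have [h1 _] := cups_ok h; have [y hy] := rch_total (x := [::]) negb true (cups_nocap ts) h1.
  by exists [::], y.
rewrite addSnnS in h; have [x [y [hx hy]]] := IH _ h.
have [h1 _] := std_out h; have [_] := rch_size hy; rewrite hx h1.
case/lastP: y hy => [//|y t] hy; rewrite size_rcons => -[hs].
exists (x ++ [:: ~~ t]), y; split; first by rewrite size_cat hx addn1.
apply/rch_cat; exists (rcons y t ++ [:: ~~ t]); split; first exact: rch_right.
exists y; split=> //; rewrite -hs cat_rcons -{3}[y]cats0; apply/lrel_cat.
by exists t.
Qed.

(** Orientations of the standard diagram are pulled back along the reduction, which avoids any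
    analysis of the strings of [u]. *)
Lemma oriented a u : ok a u -> exists x y, size x = a /\ rch negb u x y.
Proof.
move=> hu; have [ts h1 h2] := word_std hu erefl.
have [x [y [hx hy]]] := std_oriented h1; exists x, y; split=> //.
exact: (rch_mv negbK (inhabits true) h2 hx hy).
Qed.

(** * State sequences along a word *)

Section States.
Variables (X : Type) (du : X -> X) (d : X).
Hypothesis duK : involutive du.

Fixpoint chain (u : rword) (x : seq X) (zs : seq (seq X)) : Prop :=
  match u, zs with
  | [::], [::] => True
  | (k, g) :: u', z :: zs' => lrel du k g x z /\ chain u' z zs'
  | _, _ => False
  end.

Lemma rch_chain u x y : rch du u x y <-> exists2 zs, chain u x zs & last x zs = y.
Proof.
elim: u x => [|[k g] u IH] x /=.
  by split=> [<-|[[] // _ <-]]; first by exists [::].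
split=> [[z [h1 /IH[zs h2 h3]]]|[[//|z zs] [h1 h2] h3]]; first by exists (z :: zs).
by exists z; split=> //; apply/IH; exists zs.
Qed.

Lemma chainP u x zs : chain u x zs <-> size zs = size u /\
  forall i k g, i < size u -> nth (0, GS) u i = (k, g) ->
    lrel du k g (nth [::] (x :: zs) i) (nth [::] (x :: zs) i.+1).
Proof.
elim: u x zs => [|[k g] u IH] x zs /=.
  by case: zs => [|z zs]; split=> // -[].
case: zs => [|z zs]; first by split=> // -[].
split.
- case=> h1 /IH[h2 h3]; split; first by rewrite /= h2.
  by move=> [|i] k' g' /= hi; [case=> <- <- | exact: h3].
- case=> [[h1] h2]; split; first by have := h2 0 k g isT erefl.
  by apply/IH; split=> // i k' g' hi; exact: (h2 i.+1 k' g' hi).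
Qed.

Lemma lrel_nth k g x z : lrel du k g x z ->
  [/\ forall j, j < k -> nth d z j = nth d x j,
      forall j, k + src g <= j -> nth d z (j - src g + tgt g) = nth d x j &
      match g with
      | GS => nth d z k.+1 = nth d x k /\ nth d z k = nth d x k.+1
      | GCap => nth d x k.+1 = du (nth d x k)
      | GCup => nth d z k.+1 = du (nth d z k)
      end].
Proof.
elim: k x z => [|k IH] x z /=.
  case: g => [[a [b [q [-> ->]]]]|[a ->]|[a ->]]; split=> //=; case=> [|[|j]] //= _;
    rewrite ?subn2 ?subn0 ?addn0 ?addn2 //.
case: x => // a x; case: z => // b z [-> /IH[h1 h2 h3]]; split=> //.
  by case=> // j; apply: h1.
case=> // j; rewrite addSn ltnS => hj.
have -> : j.+1 - src g + tgt g = (j - src g + tgt g).+1 by lia.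
by rewrite /= h2.
Qed.

Lemma lrel_of_nth k g r x z : size x = k + src g + r -> size z = k + tgt g + r ->
  (forall j, j < k -> nth d z j = nth d x j) ->
  (forall j, k + src g <= j < k + src g + r -> nth d z (j - src g + tgt g) = nth d x j) ->
  match g with
  | GS => nth d z k.+1 = nth d x k /\ nth d z k = nth d x k.+1
  | GCap => nth d x k.+1 = du (nth d x k)
  | GCup => nth d z k.+1 = du (nth d z k)
  end -> lrel du k g x z.
Proof.
elim: k x z => [|k IH] x z hx hz h1 h2 h3.
  have tail p q : size p = r -> size q = r -> (forall j, j < r -> nth d q j = nth d p j) -> q = p.
    by move=> hp hq h; apply: (@eq_from_nth _ d); rewrite hq // => i hi; exact: h.
  case: g hx hz h2 h3 => hx hz h2 h3.
  - case: x hx h2 h3 {h1} => [|a [|b q]] // [hx] h2 h3.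
    case: z hz h2 h3 => [|a' [|b' q']] // [hz] h2 [/= -> ->].
    exists a, b, q; split=> //; congr [:: _, _ & _]; apply: tail => // j hj.
    have hj2 : 0 + src GS <= j.+2 < 0 + src GS + r by rewrite /=; lia.
    by have := h2 _ hj2; rewrite (_ : j.+2 - src GS + tgt GS = j.+2) //=; lia.
  - case: x hx h2 h3 {h1} => [|a [|b q]] // [hx] h2 /= ->.
    exists a; congr [:: _, _ & _]; symmetry; apply: tail => // j hj.
    have hj2 : 0 + src GCap <= j.+2 < 0 + src GCap + r by rewrite /=; lia.
    by have := h2 _ hj2; rewrite (_ : j.+2 - src GCap + tgt GCap = j) //=; lia.
  - case: z hz h2 h3 {h1} => [|a [|b q]] // [hz] h2 /= ->.
    exists a; congr [:: _, _ & _]; apply: tail => // j hj.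
    have hj2 : 0 + src GCup <= j < 0 + src GCup + r by rewrite /=; lia.
    by have := h2 _ hj2; rewrite (_ : j - src GCup + tgt GCup = j.+2) //=; lia.
case: x hx h1 h2 h3 => [|a x] // [hx] h1 h2 h3; case: z hz h1 h2 h3 => [|b z] // [hz] h1 h2 h3.
split; first by have := h1 0 isT.
apply: IH => //.
- by move=> j hj; exact: (h1 j.+1).
- move=> j hj; have := h2 j.+1; rewrite /= -[RHS]/(nth d (a :: x) j.+1).
  have -> : j.+1 - src g + tgt g = (j - src g + tgt g).+1 by lia.
  by apply; lia.
Qed.

Definition at_vertex (x : seq X) (zs : seq (seq X)) (v : nat * nat) : X :=
  nth d (nth [::] (x :: zs) v.1) v.2.

Lemma nth_fst (w : word) i : i < size w -> nth (0, GS) (map fst w) i = (nth dl w i).1.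
Proof. by move=> h; rewrite (nth_map dl). Qed.

Lemma edge_at w v v' : edge w v v' -> exists t, forall x zs, chain (map fst w) x zs ->
  at_vertex x zs v' = iter t du (at_vertex x zs v).
Proof.
have key i k g r : i < size w -> nth dl w i = (k, g, r) -> forall x zs,
    chain (map fst w) x zs -> lrel du k g (nth [::] (x :: zs) i) (nth [::] (x :: zs) i.+1).
  move=> hi hw x zs /chainP[_]; apply; first by rewrite size_map.
  by rewrite nth_fst // hw.
case=> {v v'}.
- move=> i k g r j hi hw hj; exists 0 => x zs /(key _ _ _ _ hi hw)/lrel_nth[h _ _].
  by rewrite /at_vertex /= h.
- move=> i k g r j hi hw /andP[hj _]; exists 0 => x zs /(key _ _ _ _ hi hw)/lrel_nth[_ h _].
  by rewrite /at_vertex /= h.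
- move=> i k r hi hw; exists 0 => x zs /(key _ _ _ _ hi hw)/lrel_nth[_ _ [h _]].
  by rewrite /at_vertex /= h.
- move=> i k r hi hw; exists 0 => x zs /(key _ _ _ _ hi hw)/lrel_nth[_ _ [_ h]].
  by rewrite /at_vertex /= h.
- move=> i k r hi hw; exists 1 => x zs /(key _ _ _ _ hi hw)/lrel_nth[_ _ h].
  by rewrite /at_vertex /= h.
- move=> i k r hi hw; exists 1 => x zs /(key _ _ _ _ hi hw)/lrel_nth[_ _ h].
  by rewrite /at_vertex /= h.
Qed.

(** The exponent depends on the path but not on the labelling, so the label at one vertex of a
    string determines all others on it. *)
Lemma linked_at w v v' : linked w v v' -> exists t, forall x zs, chain (map fst w) x zs ->
  at_vertex x zs v' = iter t du (at_vertex x zs v).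
Proof.
elim=> {v v'}.
- by move=> v v' /edge_at.
- by move=> v; exists 0.
- move=> v v' _ [t h]; exists t => x zs /h ->.
  by elim: t {h} => //= t IH; rewrite -iterSr /= duK.
- move=> v v' v'' _ [t h] _ [t' h']; exists (t' + t) => x zs hz.
  by rewrite iterD -h // h'.
Qed.

Lemma chain_size a b w x zs i : wf a b w -> chain (map fst w) x zs -> size x = a ->
  i <= size w -> size (nth [::] (x :: zs) i) = lvl a w i.
Proof.
elim: w a x zs i => [|[[k g] r] w IH] a x zs [|i] //= /andP[/eqP ha hw].
case: zs => // z zs [hl hc] hx hi.
have [_ hz] := lrel_size hl.
have {}hz : size z = k + tgt g + r by rewrite hz hx -ha /step; lia.
by rewrite /= (IH _ _ _ _ hw hc hz) //; case: i hi.
Qed.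

End States.

(** * Matrix coefficients as state sums *)

Lemma lrel_split (X : Type) (du : X -> X) k g x z : lrel du k g x z ->
  exists p X Z, [/\ size p = k, x = p ++ X, z = p ++ Z & lrel du 0 g X Z].
Proof.
elim: k x z => [|k IH] x z; first by exists [::], x, z.
case: x => // a x; case: z => // b z [<- /IH[p [Y [Z [h1 -> -> h]]]]].
by exists (a :: p), Y, Z; rewrite /= h1.
Qed.

Section StateSum.
Variables (F : fieldType) (C : finType).
Local Open Scope ring_scope.
Notation L := (C * bool)%type.
Notation dual := (@dual C).

Lemma sg_neq0 b : sg F b != 0.
Proof. by rewrite /sg signr_eq0. Qed.

Lemma act_layer_neq0 e k g r (phi : seq L -> F) x :
  act_layer e (k, g, r) phi x != 0 -> exists2 z, lrel dual k g x z & phi z != 0.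
Proof.
rewrite /act_layer; case: (size x =P _) => [hs|_] /=; last by rewrite eqxx.
have hp : size (take k x) = k by rewrite size_takel //; lia.
have cat g' Y Z : drop k x = Y -> lrel dual 0 g' Y Z -> lrel dual k g' x (take k x ++ Z).
  move=> <- /(@lrel_cat _ dual (take k x) _ _ _).2.
  by rewrite hp cat_take_drop.
case: g hs => hs /=.
- case E: (drop k x) => [|u [|v q]]; rewrite ?eqxx // mulf_eq0 negb_or => /andP[_ h].
  by eexists; last exact: h; apply: cat E _; exists u, v, q.
- case E: (drop k x) => [|u [|v q]]; rewrite ?eqxx //.
  case: (v =P _) => [ev|_]; rewrite ?eqxx // mulf_eq0 negb_or => /andP[_ h].
  by eexists; last exact: h; apply: cat E _; exists u; rewrite ev.
- rewrite mulf_eq0 negb_or => /andP[_ h].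
  case: (pickP (fun u => phi (take k x ++ [:: u, dual u & drop k x]) != 0)) => [u hu|h0].
    by eexists; last exact: hu; apply: cat erefl _; exists u.
  by case/eqP: h; apply: big1 => u _; rewrite (eqP (negbFE (h0 u))) mulr0.
Qed.

Lemma act_neq0 e w (phi : seq L -> F) x : act e w phi x != 0 ->
  exists2 y, rch dual (map fst w) x y & phi y != 0.
Proof.
elim: w x => [|[[k g] r] w IH] x; first by exists x.
case/act_layer_neq0=> z h1 /IH[y h2 h3]; exists y => //=.
by exists z.
Qed.

(** A crossing or a cap has at most one compatible upper state; for a cup the hypothesis on [phi]
    leaves one term of the sum. *)
Lemma act_layer_single e k g r (phi : seq L -> F) x z :
  lrel dual k g x z -> size x = (k + src g + r)%N ->
  (forall z', lrel dual k g x z' -> z' != z -> phi z' = 0) ->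
  exists s, act_layer e (k, g, r) phi x = sg F s * phi z.
Proof.
case/lrel_split=> p [X [Z [hp -> -> h]]] hs hz.
rewrite /act_layer hs eqxx /= -hp take_size_cat // drop_size_cat //.
case: g h hs hz => /=.
- by case=> u [v [q [-> ->]]] _ _; exists (u.2 && v.2).
- by case=> u -> _ _; rewrite eqxx; eexists.
- case=> u -> _ hz; exists ((e (+) par p) (+) u.2); rewrite [in RHS]sgD -mulrA; congr (_ * _).
  rewrite (bigD1 u) //= big1 ?addr0 // => v hv; rewrite hz ?mulr0 //.
    by rewrite -hp; apply/lrel_cat; exists v.
  by rewrite eqseq_cat // eqxx /= eqseq_cons (negbTE hv).
Qed.

Definition delta (y z : seq L) : F := (z == y)%:R.

Lemma act_single e a b w x zs : wf a b w -> size x = a -> chain dual (map fst w) x zs ->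
  (forall zs', chain dual (map fst w) x zs' -> last x zs' = last x zs -> zs' = zs) ->
  act e w (delta (last x zs)) x != 0.
Proof.
elim: w a x zs => [|[[k g] r] w IH] a x zs /=.
  by move=> _ _; case: zs => // _ _; rewrite /delta eqxx oner_neq0.
case: zs => [|z zs] /andP[/eqP ha hw] hx // [hl hc] hu /=.
have hz : size z = (k + tgt g + r)%N.
  by have [_ ->] := lrel_size hl; rewrite hx -ha /step; lia.
have [||s ->] := act_layer_single e (r := r) (phi := act e w (delta (last z zs))) hl.
- by rewrite hx -ha.
- move=> z' hl' hz'; apply/eqP; apply: contraNT hz' => /act_neq0[y hy].
  rewrite /delta; case: (y =P _) => [ey _|_]; last by rewrite eqxx.
  have [zs' h1 h2] := (rch_chain dual _ _ _).1 hy.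
  have := hu (z' :: zs'); rewrite /= h2 ey => H.
  by case: (H (conj hl' h1) erefl) => ->.
rewrite mulf_neq0 ?sg_neq0 //; apply: IH hw hz hc _ => zs' h1 h2.
by have := hu (z :: zs'); rewrite /= h2 => /(_ (conj hl h1) erefl)[].
Qed.

End StateSum.

(** * Independence of the connectors *)

Section Generic.
Variables (F : fieldType) (a b : nat).
Notation pt := ('I_a + 'I_b)%type.
Notation C := {set pt}.
Notation L := (C * bool)%type.

(** The colours are the strings of [c] themselves, as two-element sets of end points. *)
Definition colour (c : conn a b) (p : pt) : C := [set p; c p].

Lemma conn_fun (c : conn a b) p : c (c p) = p /\ c p != p.
Proof. by have /forallP/(_ p)/andP[/eqP] := cvalP c. Qed.

Lemma colour_conn c p : colour c (c p) = colour c p.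
Proof. by rewrite /colour (conn_fun c p).1 setUC. Qed.

Lemma colour_inj c p q : colour c p = colour c q -> p != q -> c p = q.
Proof.
move=> /setP/(_ q); rewrite !inE eqxx /= eq_sym => + /negbTE hpq.
by rewrite hpq /= => /eqP.
Qed.

(** Since [linked] is only [Prop]-valued, an end point is selected for each vertex by finite choice
    over a grid containing all valid vertices. *)
Lemma state_colouring (c : conn a b) w : no_loops a b w ->
  exists col : nat * nat -> C, forall v, valid a w v ->
    exists2 p, linked w v (pvert w p) & col v = colour c p.
Proof.
move=> hl.
pose M := (\max_(i < (size w).+1) lvl a w i).
have H (x : 'I_(size w).+1 * 'I_M) : exists t : C, valid a w (val x.1, val x.2) ->
    exists2 p, linked w (val x.1, val x.2) (pvert w p) & t = colour c p.
  case: (boolP (val x.2 < lvl a w (val x.1))) => hx; last first.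
    by exists set0 => -[_ /=]; rewrite (negbTE hx).
  have hv : valid a w (val x.1, val x.2) by split=> //=; case: x.1 => /= i; rewrite ltnS.
  by have [p hp] := hl _ hv; exists (colour c p) => _; exists p.
have [f hf] := fin_all_exists H.
exists (fun v => if insub v.1 is Some i then if insub v.2 is Some j then f (i, j) else set0
        else set0) => -[i j] /[dup] hv [/= hi hj].
have hi' : i < (size w).+1 by [].
rewrite (insubT (fun i => i < (size w).+1) hi').
have hj' : j < M.
  apply: leq_trans hj _.
  exact: (leq_bigmax (F := fun i : 'I_(size w).+1 => lvl a w i) (Ordinal hi')).
rewrite (insubT (fun i => i < M) hj').
exact: (hf (Ordinal hi', Ordinal hj')).
Qed.

Lemma colour_linked (c : conn a b) w p q : has_conn w c -> linked w (pvert w p) (pvert w q) ->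
  colour c p = colour c q.
Proof.
move=> hc h; case: (eqVneq p q) => [-> //|hpq].
by have <- := (hc p q hpq).2 h; rewrite colour_conn.
Qed.

Lemma wf_nth w i : wf a b w -> i < size w -> lsrc (nth dl w i) = lvl a w i.
Proof.
move: (a) => a0; elim: w a0 i => [|l w IH] a0 [|i] //= /andP[/eqP h1 h2] hi //.
by rewrite (IH _ _ h2 hi); case: i hi.
Qed.

Lemma wf_top w : wf a b w -> lvl a w (size w) = b.
Proof.
move: (a) => a0; elim: w a0 => [|l w IH] a0 /=; first by move/eqP.
case/andP=> _ /IH; by case: (w).
Qed.

(** Each vertex is labelled by the colour of its string together with the orientation given by
    [oriented]; the parts agree with every layer separately. *)
Lemma generic_states (c : conn a b) w :
  wf a b w -> no_loops a b w -> has_conn w c ->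
  exists x y : seq L, [/\ size x = a, size y = b,
    forall p : pt, (match p with inl j => nth (set0, true) x j
                    | inr j => nth (set0, true) y j end).1 = colour c p &
    act false w (delta F y) x != 0%R].
Proof.
move=> hw hl hc; have [col hcol] := state_colouring c hl.
have [hok _ _] := wf_el hw.
have [px [py [hpx hpy]]] := oriented hok.
have [pz hpz _] := (rch_chain negb _ _ _).1 hpy.
pose st i : seq L :=
  mkseq (fun j => (col (i, j), nth true (nth [::] (px :: pz) i) j)) (lvl a w i).
pose zs := mkseq (fun i => st i.+1) (size w).
have nst i : i <= size w -> nth [::] (st 0 :: zs) i = st i.
  by case: i => //= i hi; rewrite nth_mkseq.
have cedge v v' : edge w v v' -> valid a w v -> valid a w v' -> col v = col v'.
  move=> he /hcol[p hp ->] /hcol[q hq ->]; apply: colour_linked hc _.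
  apply: rst_trans (rst_sym _ _ _ _ hp) _; apply: rst_trans hq.
  exact: rst_step.
have nthst i j : j < lvl a w i -> nth (set0, true) (st i) j =
    (col (i, j), nth true (nth [::] (px :: pz) i) j) by move=> h; rewrite nth_mkseq.
have hch : chain (@dual _) (map fst w) (st 0) zs.
  apply/chainP; split; first by rewrite size_mkseq size_map.
  move=> i k g; rewrite size_map => hi; rewrite nth_fst //.
  case E: (nth dl w i) => [[k' g'] r] [<- <-] {k g}; rename k' into k; rename g' into g.
  have [_ /(_ i k g)] := (chainP negb _ _ _).1 hpz.
  rewrite size_map nth_fst // E => /(_ hi erefl)/(lrel_nth true)[h1 h2 h3].
  have l0 : lvl a w i = k + src g + r by rewrite -wf_nth // E.
  have l1 : lvl a w i.+1 = k + tgt g + r by rewrite /= E.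
  have vv j : j < lvl a w i -> valid a w (i, j) by move=> h; split=> //=; exact: ltnW.
  have vv' j : j < lvl a w i.+1 -> valid a w (i.+1, j) by move=> h; split.
  rewrite (nst i (ltnW hi)) (nst i.+1 hi).
  apply: (@lrel_of_nth _ _ (set0, true) _ _ r); rewrite ?size_mkseq //.
  - move=> j hj; rewrite !nthst ?l0 ?l1; [|lia..]; rewrite h1 //; congr pair.
    by symmetry; apply: cedge (e_left hi E hj) _ _; [apply: vv | apply: vv']; lia.
  - move=> j hj; rewrite !nthst ?l0 ?l1; [|lia..]; rewrite h2; last by lia.
    congr pair; symmetry.
    by apply: cedge (e_right hi E hj) _ _; [apply: vv | apply: vv']; lia.
  - case: g E h1 h2 h3 l0 l1 => E h1 h2 h3 l0 l1; rewrite /= in l0 l1 h3 *.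
    + rewrite !nthst ?l0 ?l1 /= ?E /=; [|lia..].
      case: h3 => -> ->; split; congr pair; symmetry.
        by apply: cedge (e_cross1 hi E) _ _; [apply: vv | apply: vv']; rewrite /= ?E /=; lia.
      by apply: cedge (e_cross2 hi E) _ _; [apply: vv | apply: vv']; rewrite /= ?E /=; lia.
    + rewrite !nthst ?l0 ?l1 /= ?E /=; [|lia..].
      rewrite h3 /dual; congr pair; symmetry.
      by apply: cedge (e_cap hi E) _ _; apply: vv; rewrite /= ?E /=; lia.
    + rewrite !nthst ?l0 ?l1 /= ?E /=; [|lia..].
      rewrite h3 /dual; congr pair; symmetry.
      by apply: cedge (e_cup hi E) _ _; apply: vv'; rewrite /= ?E /=; lia.
have top : last (st 0) zs = st (size w).
  by rewrite (last_nth [::]) size_mkseq nst.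
exists (st 0), (st (size w)); split.
- by rewrite size_mkseq.
- by rewrite size_mkseq wf_top.
- have colp p : valid a w (pvert w p) -> col (pvert w p) = colour c p.
    by case/hcol=> q hq ->; symmetry; apply: colour_linked hc hq.
  case=> j; rewrite nthst /= ?wf_top //.
    by apply: (colp (inl j)); split=> /=.
  by apply: (colp (inr j)); split=> /=; rewrite ?wf_top.
rewrite -top; apply: (@act_single F _ false a b w _ zs hw _ hch); first by rewrite size_mkseq.
(* Uniqueness: every vertex is linked to an end point, whose label is fixed by the bottom or the top
   state, and [linked_at] transports it. *)
move=> zs' hch' hlast.
have s1 : size zs = size w by rewrite size_mkseq.
have s2 : size zs' = size w by have [->] := (chainP _ _ _ _).1 hch'; rewrite size_map.
apply: (@eq_from_nth _ [::]); rewrite s2 ?s1 // => i hi.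
have z1 := chain_size hw hch (size_mkseq _ _) (i := i.+1) hi.
have z2 := chain_size hw hch' (size_mkseq _ _) (i := i.+1) hi.
apply: (@eq_from_nth _ (set0, true)); rewrite /= in z1 z2; rewrite z2 ?z1 // => j hj.
have [p hp] := hl (i.+1, j) (conj hi hj).
have [t ht] := @linked_at L (@dual _) (set0, true) (@dualK _) _ _ _ (rst_sym _ _ _ _ hp).
have := ht _ _ hch; have := ht _ _ hch'; rewrite /at_vertex /= => -> ->.
congr (iter t _ (nth _ _ _)); case: p {hp ht} => k //=.
by rewrite -{1}s2 -s1 -!(last_nth [::]).
Qed.

(** Since [dual] preserves colours, a string of [w] joins end points of equal colour, and these are
    partners under [c]. *)
Lemma conn_of_states (c c' : conn a b) w x y : has_conn w c' ->
  (forall p : pt, (match p with inl j => nth (set0, true) x j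
                    | inr j => nth (set0, true) y j end).1 = colour c p) ->
  act false w (delta F y) x != 0%R -> c' = c.
Proof.
move=> hc' hcol /act_neq0[y' /(rch_chain _ _ _ _).1[zs hzs hlast]].
rewrite /delta; case: (y' =P _) => [ey _|_]; last by rewrite eqxx.
rewrite {y'}ey in hlast.
apply/val_inj/ffunP => p; symmetry.
have hpq : p != c' p by rewrite eq_sym (conn_fun c' p).2.
apply: (colour_inj _ hpq).
have [t ht] := @linked_at L (@dual _) (set0, true) (@dualK _) _ _ _ ((hc' _ _ hpq).1 erefl).
have ez : size zs = size w by have [->] := (chainP _ _ _ _).1 hzs; rewrite size_map.
have fst_at q : (at_vertex (set0, true) x zs (pvert w q)).1 = colour c q.
  rewrite -hcol; case: q => j //=; rewrite /at_vertex /=.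
  by rewrite -ez -(last_nth [::]) hlast.
have := ht _ _ hzs => /(congr1 fst); rewrite !fst_at => ->.
by rewrite -fst_at; elim: t {ht} => //= t IH.
Qed.

End Generic.

(** * Counting perfect matchings *)

Section Matchings.
Variable T : finType.

(** Matchings of [A] are extended by the identity, so that the induction over subsets stays within
    one function type. *)
Definition matching_on (A : {set T}) (f : {ffun T -> T}) : bool :=
  [forall x, (f (f x) == x) && ((f x != x) == (x \in A))].

Definition matching_number (n : nat) := if odd n then 0 else dfact n.-1.

Lemma matching_numberSS n : matching_number n.+2 = n.+1 * matching_number n.
Proof. by rewrite /matching_number /= negbK; case: n => [|n] //=; case: odd; rewrite ?muln0. Qed.

Lemma matching_onP (A : {set T}) (f : {ffun T -> T}) : reflect
  ((forall x, f (f x) = x) /\ forall x, (f x != x) = (x \in A)) (matching_on A f).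
Proof.
apply: (iffP forallP) => [h|[h1 h2] x]; last by rewrite h1 h2 !eqxx.
by split=> x; have /andP[/eqP ? /eqP] := h x.
Qed.

Lemma card_matching_pair (A : {set T}) x y : x \in A -> y \in A -> x != y ->
  #|[set f | matching_on A f & f x == y]| = #|[set f | matching_on (A :\: [set x; y]) f]|.
Proof.
move=> hx hy hxy.
pose add (f : {ffun T -> T}) := [ffun z => if z == x then y else if z == y then x else f z].
have inj : {in [set f | matching_on (A :\: [set x; y]) f] &, injective add}.
  move=> f g; rewrite !inE => /matching_onP[_ hf] /matching_onP[_ hg] /ffunP e.
  have fix_ (h : {ffun T -> T}) : (forall z, (h z != z) = (z \in A :\: [set x; y])) ->
      h x = x /\ h y = y.
    by move=> hh; split; apply/eqP/negbFE; rewrite hh !inE eqxx ?orbT.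
  have [fx fy] := fix_ _ hf; have [gx gy] := fix_ _ hg.
  apply/ffunP => z; have := e z; rewrite !ffunE.
  by case: eqP => [->|_]; [rewrite fx gx|case: eqP => [->|_] //; rewrite fy gy].
rewrite -(card_in_imset inj); apply: eq_card => f; apply/idP/imsetP.
- rewrite inE => /andP[/matching_onP[h1 h2] /eqP fx].
  have fy : f y = x by rewrite -fx h1.
  exists [ffun z => if (z == x) || (z == y) then z else f z].
    rewrite inE; apply/matching_onP; split=> z; rewrite !ffunE.
      case: (boolP ((z == x) || (z == y))) => hz; first by rewrite hz.
      case: ifP => [/orP[] /eqP e|_]; last exact: h1.
        by move: hz; rewrite -(h1 z) e fx eqxx orbT.
      by move: hz; rewrite -(h1 z) e fy eqxx.
    by rewrite !inE; case: ifP => hz; rewrite ?eqxx //= h2.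
  apply/ffunP => z; rewrite !ffunE.
  case: (eqVneq z x) => [->|zx]; first by rewrite fx.
  by case: (eqVneq z y) => [->|zy]; [rewrite fy|].
- case=> g; rewrite inE => /matching_onP[h1 h2] ->.
  have gx : g x = x by apply/eqP/negbFE; rewrite h2 !inE eqxx.
  have gy : g y = y by apply/eqP/negbFE; rewrite h2 !inE eqxx orbT.
  have gN z : z != x -> z != y -> (g z != x) && (g z != y).
    move=> zx zy; apply/andP; split; apply/eqP => e.
      by move: zx; rewrite -(h1 z) e gx eqxx.
    by move: zy; rewrite -(h1 z) e gy eqxx.
  rewrite inE !ffunE !eqxx andbT; apply/matching_onP; split=> z; rewrite !ffunE.
    case: (eqVneq z x) => [->|zx]; first by rewrite eq_sym (negbTE hxy) eqxx.
    case: (eqVneq z y) => [->|zy]; first by rewrite eqxx.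
    by have /andP[/negbTE -> /negbTE ->] := gN z zx zy.
  case: (eqVneq z x) => [->|zx]; first by rewrite eq_sym hxy hx.
  case: (eqVneq z y) => [->|zy]; first by rewrite hxy hy.
  by rewrite h2 !inE (negbTE zx) (negbTE zy).
Qed.

(** Sorting by the partner of a fixed point gives [n.-1] equal contributions, one for each
    partner. *)
Lemma card_matching_on n (A : {set T}) : #|A| = n -> #|[set f | matching_on A f]| = matching_number n.
Proof.
elim/ltn_ind: n A => n IH A hA.
case: (set_0Vmem A) => [A0|[x hx]].
  move: hA; rewrite A0 cards0 => <-; rewrite (_ : [set f | _] = [set [ffun z => z]]) ?cards1 //.
  apply/setP => f; rewrite !inE; apply/matching_onP/eqP => [[_ h]|->].
    by apply/ffunP => z; rewrite ffunE; apply/eqP/negbFE; rewrite h inE.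
  by split=> z; rewrite !ffunE // inE eqxx.
have -> : #|[set f | matching_on A f]| =
    \sum_(y in A :\ x) #|[set f | matching_on A f & f x == y]|.
  rewrite -sum1_card (partition_big (fun f : {ffun T -> T} => f x) (mem (A :\ x))) /=; last first.
    move=> f; rewrite inE => /matching_onP[h1 h2].
    by rewrite !inE h2 hx -h2 h1 eq_sym h2 hx.
  apply: eq_bigr => y _; rewrite -sum1_card; apply: eq_bigl => f.
  by rewrite !inE.
have hc : #|A :\ x| = n.-1 by rewrite (cardsD1 x A) hx in hA; lia.
case: n hA IH hc => [|[|n]] hA IH hc.
- by move: hA; rewrite (cardsD1 x A) hx.
- by rewrite (cards0_eq hc) big_set0.
- rewrite (eq_bigr (fun _ => matching_number n)) ?sum_nat_const ?hc ?matching_numberSS // => y.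
  rewrite !inE => /andP[yx yA]; rewrite card_matching_pair // 1?eq_sym //.
  apply: IH; first by lia.
  rewrite cardsD hA (setIidPr _) ?cards2 1?eq_sym ?yx //; first by lia.
  by apply/subsetP => z; rewrite !inE => /orP[] /eqP ->.
Qed.
End Matchings.

Lemma card_conn a b : #|conn a b| = matching_number (a + b).
Proof.
have -> : #|conn a b| = #|[set f : {ffun ('I_a + 'I_b) -> 'I_a + 'I_b} | matching_on setT f]|.
  rewrite card_sub cardsE; apply: eq_card => f; rewrite !inE.
  apply: eq_forallb => x; by rewrite inE eqb_id.
by apply: card_matching_on; rewrite cardsT card_sum !card_ord.
Qed.

Lemma size_codes n : size (codes n) = matching_number n.
Proof.
elim/ltn_ind: n => -[|[|n]] IH //.
by rewrite [codes _]/(allpairs _ (iota 0 n.+1) _) size_allpairs size_iota IH ?matching_numberSS.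
Qed.

(** * The basis theorem *)

Lemma wf_std (F : fieldType) a b w : (2%:R != 0 :> F)%R -> wf a b w ->
  exists2 ts, ts \in codes (a + b) & exists c : F, weq a b c w (el a (std a b ts)).
Proof.
move=> h2 hw; have [hok hout hel] := wf_el hw.
have [ts hts hmv] := word_std hok hout; exists ts => //.
by have [c] := mv_weq h2 hmv hok; rewrite hout hel; exists c.
Qed.

Section Basis.
Variables (F : fieldType) (a b : nat) (d : conn a b -> word).
Hypothesis two_neq0 : (2%:R != 0 :> F)%R.
Hypothesis d_wf : forall c, wf a b (d c).
Hypothesis d_noloops : forall c, no_loops a b (d c).
Hypothesis d_conn : forall c, has_conn (d c) c.
Local Open Scope ring_scope.

(** Evaluation at the generic states of [c] annihilates the terms of all other connectors. *)
Lemma basis_free (lam : conn a b -> F) :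
  ideal a b [seq (lam c, d c) | c <- enum (conn a b)] -> forall c, lam c = 0.
Proof.
move=> h c.
have [x [y [hx hy hcol hne]]] := generic_states F (d_wf c) (@d_noloops c) (@d_conn c).
have := act_ideal h false (delta F y) hx; rewrite /eval big_map big_enum /=.
rewrite (bigD1 c) //= big1 ?addr0 => [/eqP|c' hc'].
  by rewrite mulf_eq0 (negbTE hne) orbF => /eqP.
apply/eqP; rewrite mulf_eq0; apply/orP; right; apply: contraNT hc' => hne'.
by apply/eqP; apply: conn_of_states (@d_conn c') hcol hne'.
Qed.

(** Nonzero coefficients of [d c] force nonzero scalars. Generic states separate the connectors, so
    [c] determines its code injectively, and equal cardinalities make this surjective. *)
Lemma basis_standard : exists f : conn a b -> seq nat * F,
  [/\ forall c, weq a b (f c).2 (d c) (el a (std a b (f c).1)),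
      forall c, (f c).2 != 0 &
      forall ts, ts \in codes (a + b) -> exists c, ts = (f c).1].
Proof.
have H c : exists t : seq nat * F, t.1 \in codes (a + b) /\
    weq a b t.2 (d c) (el a (std a b t.1)).
  by have [ts h1 [l h2]] := wf_std two_neq0 (d_wf c); exists (ts, l).
have [f hf] := fin_all_exists H.
have act_f c' (x y : seq ({set 'I_a + 'I_b} * bool)) : size x = a ->
    act false (d c') (delta F y) x =
    (f c').2 * act false (el a (std a b (f c').1)) (delta F y) x.
  move=> hx; have := act_ideal (hf c').2 false (delta F y) hx.
  by rewrite eval2 mul1r mulNr => /eqP; rewrite subr_eq0 => /eqP.
have f_neq0 c : (f c).2 != 0.
  have [x [y [hx _ _]]] := generic_states F (d_wf c) (@d_noloops c) (@d_conn c).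
  by rewrite act_f // mulf_eq0 negb_or => /andP[].
exists f; split=> [c||ts hts] //; first by have [] := hf c.
have inj : injective (fun c => (f c).1).
  move=> c c' e.
  have [x [y [hx hy hcol]]] := generic_states F (d_wf c) (@d_noloops c) (@d_conn c).
  rewrite act_f // mulf_eq0 negb_or => /andP[_ hne].
  symmetry; apply: (@conn_of_states F a b c c' (d c') x y) => //.
  by rewrite act_f // mulf_neq0 // -e.
have [|||_ E] := @uniq_min_size _ [seq (f c).1 | c <- enum (conn a b)] (codes (a + b)).
- by rewrite map_inj_uniq // enum_uniq.
- by move=> s /mapP[c _ ->]; have [] := hf c.
- by rewrite size_map -cardE card_conn size_codes.
by move: hts; rewrite -E => /mapP[c _ ->]; exists c.
Qed.

(** The word [w] is a multiple of a standard diagram, of which some [d c] is a nonzero multiple; a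
    single coefficient suffices. *)
Lemma basis_spans (w : word) : wf a b w -> exists lam : conn a b -> F,
  ideal a b ((1, w) :: [seq (- lam c, d c) | c <- enum (conn a b)]).
Proof.
move=> hw; have [f [f1 f2 f3]] := basis_standard.
have [ts /f3[c ->] [l hl]] := wf_std two_neq0 hw.
have h := weq_trans hl (weq_sym (f2 c) (f1 c)).
exists (fun c' => if c' == c then l / (f c).2 else 0).
apply: id_ext h _ => v; rewrite !comb_coef_cons comb_coef_nil addr0; congr (_ + _).
rewrite /coef big_map big_enum_cond /=.
case: ifP => hv; last first.
  rewrite big1 // => c' /eqP e; case: eqP => [ec|_]; last exact: oppr0.
  by rewrite -e ec eqxx in hv.
rewrite (bigD1 c) //= eqxx big1 ?addr0 // => c' /andP[_ /negbTE ->].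
by rewrite oppr0.
Qed.
End Basis.

Theorem theorem1 (F : numClosedFieldType) (a b : nat) (d : conn a b -> word)
  (hd : forall c : conn a b,
      [/\ wf a b (d c), no_loops a b (d c), normal (d c) & has_conn (d c) c]) :
  [/\ (* S_{a,b} spans Hom(a,b) = Free(a,b) / ideal a b *)
      (forall w : word, wf a b w -> exists lam : conn a b -> F,
         ideal a b ((1%R, w) :: [seq ((- lam c)%R, d c) | c <- enum (conn a b)])),
      (* S_{a,b} is linearly independent in Hom(a,b) *)
      (forall lam : conn a b -> F,
         ideal a b [seq (lam c, d c) | c <- enum (conn a b)] -> forall c, lam c = 0%R)
    & (* hence dim Hom(a,b) = #|Conn(a,b)| = (a+b-1)!! or 0 *)
      #|conn a b| = (if odd (a + b) then 0 else dfact (a + b).-1)].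
Proof.
have two_neq0 : (2%:R != 0 :> F)%R by rewrite Num.Theory.pnatr_eq0.
have h1 c : wf a b (d c) by case: (hd c).
have h2 c : no_loops a b (d c) by case: (hd c).
have h3 c : has_conn (d c) c by case: (hd c).
split; [exact: basis_spans | exact: basis_free | exact: card_conn].
Qed.
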